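(* Let $\epsilon \in (0,1)$. There is a streaming algorithm for $\epsilon$-additive approximation of the empirical Shannon entropy of an insertion-only stream in the random oracle model, which succeeds with probability $3/4$. The space required by the algorithm is $O\!\left(\frac{1}{\epsilon^2}(\log\log n + \log(1/\epsilon))\right)$ bits.
   Context: Insertion-only streaming model: a vector $\mathcal{X} \in \mathbb{Z}^n$ starts at $0$ and receives updates $(i_t,\Delta_t)$ with $\Delta_t \in \{0,\dots,M\}$, causing $\mathcal{X}_{i_t} \leftarrow \mathcal{X}_{i_t}+\Delta_t$; the stream length and $M$ are $\mathrm{poly}(n)$. The empirical Shannon entropy is $H = \sum_{i=1}^n \frac{|\mathcal{X}_i|}{\|\mathcal{X}\|_1}\log\frac{\|\mathcal{X}\|_1}{|\mathcal{X}_i|}$ for the final vector $\mathcal{X}$. The goal is $\tilde{H}$ with $|\tilde{H}-H|\le\epsilon$. Random oracle model: the algorithm has query access to an arbitrarily long string of random bits, which is not counted against its space. *)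

(* Defs.v *)
From HB Require Import structures.
From mathcomp Require Import all_boot all_order all_algebra.
From mathcomp Require Import reals exp.

Set Implicit Arguments.
Unset Strict Implicit.
Unset Printing Implicit Defensive.

Import Order.TTheory GRing.Theory Num.Theory.

Local Open Scope ring_scope.

Definition log2 {R : realType} (x : R) : R := ln x / ln 2.

Definition update (n M : nat) : finType := ('I_n * 'I_M.+1)%type.

Definition apply_update n M (X : 'rV[int]_n) (u : update n M) : 'rV[int]_n :=
  \row_j (X 0 j + (if j == u.1 then (val u.2)%:Z else 0)).

Definition final_vector n M (s : seq (update n M)) : 'rV[int]_n :=
  foldl (@apply_update n M) 0 s.

Definition l1norm (R : realType) n (X : 'rV[int]_n) : R :=
  \sum_(i < n) `|X 0 i|%:~R.

(* Coordinates X_i = 0 contribute 0, the usual convention 0 * log (1/0) = 0;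
   since x / 0 = 0 here, the zero vector has entropy 0. *)
Definition entropy (R : realType) n (X : 'rV[int]_n) : R :=
  \sum_(i < n) (`|X 0 i|%:~R / l1norm R X) * log2 (l1norm R X / `|X 0 i|%:~R).

Definition prob (R : realType) (T : finType) (E : pred T) : R :=
  #|E|%:R / #|T|%:R.

(* One-pass algorithm in the random oracle model.  The memory carried from one
   update to the next is exactly [mem_bits] bits.  The oracle string is the same at
   every step, is read freely, is as long as the algorithm wishes, and is not
   charged.  Besides the oracle, each update gets [ncoins] fresh coin flips,
   lost afterwards unless recorded in the memory (as in a Morris counter).
   [step] has no access to the time: a clock would have to be kept in the
   memory.  [answer] needs no coins of its own, as oracle bits never read by
   [step] are available to it. *)
Record streaming_alg (R : realType) (n M : nat) := StreamingAlg {
  mem_bits : nat;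
  oracle_len : nat;
  ncoins : nat;
  init : mem_bits.-tuple bool;
  step : oracle_len.-tuple bool -> ncoins.-tuple bool -> update n M ->
         mem_bits.-tuple bool -> mem_bits.-tuple bool;
  answer : oracle_len.-tuple bool -> mem_bits.-tuple bool -> R
}.

Section Run.
Variables (R : realType) (n M : nat) (A : streaming_alg R n M).

(* The oracle string, and the fresh coins of each of the k updates. *)
Definition randomness (k : nat) : finType :=
  ((oracle_len A).-tuple bool * k.-tuple ((ncoins A).-tuple bool))%type.

Definition run k (s : k.-tuple (update n M)) (w : randomness k) : R :=
  answer w.1 (foldl (fun q (uc : update n M * (ncoins A).-tuple bool) =>
                       step w.1 uc.2 uc.1 q)
                    (init A) (zip s w.2)).

End Run.

(* Main.v *)
(** Let p_i = X_i / F be the frequency vector, F = ||X||_1 and H = - sum_i p_i ln p_i.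
    If V is integer valued with P(V >= v) = 1/v, then for small t
      E exp(-t V) = 1 - (e^t - 1) * sum_v e^(-t v) / v = 1 + (e^t - 1) ln (1 - e^(-t)),
    whose logarithm is t ln t up to a lower order term.  Hence if r_i is a sum
    of N independent copies of V, the sketch S = sum_i X_i r_i satisfies
      E exp(-S / (N F)) ~ prod_i (p_i / N)^(p_i) = e^(-H) / N,
    and doubling the exponent only multiplies the square of this mean by 4.  By
    Chebyshev's inequality the average of O(1/eps^2) independent copies of
    exp(-S / (N F)) determines H up to eps.  Unlike for the usual skewed stable
    sketch, all increments are nonnegative, so every S, and F itself, can be kept
    in a floating point counter with unbiased randomized rounding; with b bits of
    mantissa the variance of the counter is at most S^2 / 2^b.  The weights r_i are
    read off the oracle, and mantissa and exponent take O(loglog n + log (1/eps))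
    bits. *)

Require Import Defs.
From mathcomp Require Import all_boot all_order all_algebra.
From mathcomp Require Import reals exp.
From mathcomp Require Import boolp functions topology normedtype sequences.
From mathcomp Require Import derive realfun.
From mathcomp Require Import zify ring lra.

Set Implicit Arguments.
Unset Strict Implicit.
Unset Printing Implicit Defensive.

Import Order.TTheory GRing.Theory Num.Theory.
Import numFieldNormedType.Exports.

Local Open Scope ring_scope.

(** * Moment generating function of the discrete Pareto law *)

(** Mean value theorem on [[0, x]] for the partial sum plus [ln (1 - y)]: the derivative is minus
    the geometric tail [y ^+ Q / (1 - y)]. *)
Lemma ln_series_bounds (R : realType) (Q : nat) (x : R) : 0 <= x -> x < 1 ->
  - ln (1 - x) - x ^+ Q.+1 / (1 - x) <=
    \sum_(v < Q) x ^+ v.+1 / v.+1%:R <= - ln (1 - x).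
Proof.
move=> x_ge0 x_lt1.
pose h (v : 'I_Q) : R -> R := fun y => v.+1%:R^-1 * y ^+ v.+1.
pose f : R -> R := (\sum_(v < Q) h v) + (fun y => ln (1 - y)).
have df (y : R) : y < 1 -> is_derive y 1 f (\sum_(v < Q) y ^+ v - (1 - y)^-1).
  move=> y_lt1.
  have dy : 0 < 1 - y by rewrite subr_gt0.
  apply: is_deriveD; first apply: is_derive_sum => v.
    have hE : h v = v.+1%:R^-1 \*: ((@id R) ^+ v.+1).
      by apply/funext => z; rewrite /h exprfctE.
    rewrite hE; apply: is_derive_eq.
    by rewrite /GRing.scale /= mulr1 mulrA mulVf ?mul1r // pnatr_eq0.
  have dln := is_derive1_ln dy.
  have dB : is_derive y 1 (fun z : R => 1 - z) (0 - 1) by apply: is_deriveB.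
  have := @is_derive1_comp _ (@ln R) (fun z : R => 1 - z) y _ _ dln dB.
  by rewrite sub0r mulrN1.
have fE y : f y = \sum_(v < Q) y ^+ v.+1 / v.+1%:R + ln (1 - y).
  rewrite /f /= fct_sumE; congr (_ + _); apply: eq_bigr => v _.
  by rewrite /h mulrC.
have [||z /[!in_itv]/= /andP[z_ge0 z_le] ] := 
  @MVT_segment R f (fun y => \sum_(v < Q) y ^+ v - (1 - y)^-1) 0 x x_ge0.
- by move=> y /[!in_itv]/= /andP[_ yx]; apply: df; apply: lt_trans x_lt1.
- apply: derivable_within_continuous => y /[!in_itv]/= /andP[_ yx].
  by case: (df y (le_lt_trans yx x_lt1)).
have z_lt1 : 0 < 1 - z by rewrite subr_gt0; apply: le_lt_trans x_lt1.
have f0 : f 0 = 0.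
  by rewrite fE subr0 ln1 addr0 big1 // => v _; rewrite exprS !mul0r.
rewrite f0 !subr0 fE.
have -> : \sum_(v < Q) z ^+ v - (1 - z)^-1 = - (z ^+ Q / (1 - z)).
  have := subrX1 z Q; rewrite -opprB -[z - 1]opprB mulNr => /oppr_inj gs.
  apply: (mulfI (lt0r_neq0 z_lt1)).
  rewrite mulrBr -gs mulfV ?lt0r_neq0 // mulrN mulrCA mulfV ?lt0r_neq0 //; ring.
move=> fx.
have -> : \sum_(v < Q) x ^+ v.+1 / v.+1%:R = - ln (1 - x) - z ^+ Q / (1 - z) * x.
  by rewrite -mulNr -fx; ring.
have zq0 : 0 <= z ^+ Q / (1 - z) by rewrite divr_ge0 ?exprn_ge0 // ltW.
rewrite lerD2l lerN2 gerDl oppr_le0 mulr_ge0 // andbT exprSr [leRHS]mulrAC.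
apply: ler_wpM2r => //; apply: ler_pM => //; first by rewrite exprn_ge0.
- by rewrite invr_ge0 ltW.
- by apply: lerXn2r; rewrite ?nnegrE.
- by rewrite lef_pV2 ?posrE ?subr_gt0 //; lra.
Qed.

(* [Q %/ u.+1] with [u] uniform in ['I_Q] is a discrete Pareto variable: it is at
   least [v] with probability [(Q %/ v) / Q], which is nearly [1 / v]. *)
Definition pareto_mgf (R : realType) (Q : nat) (t : R) : R :=
  (\sum_(u < Q) expR (- (t * (Q %/ u.+1)%:R))) / Q%:R.

(** Abel summation: [x ^+ V] is 1 minus [1 - x] times a geometric sum, and the two sums are
    exchanged. *)
Lemma sum_expr_divn (R : realType) (Q : nat) (x : R) :
  \sum_(u < Q) x ^+ (Q %/ u.+1) =
  Q%:R - (1 - x) * \sum_(v < Q) x ^+ v * (Q %/ v.+1)%:R.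
Proof.
have geo (V : nat) : (V <= Q)%N ->
    x ^+ V = 1 - (1 - x) * \sum_(v < Q) x ^+ v * (v < V)%N%:R.
  move=> VQ.
  have -> : \sum_(v < Q) x ^+ v * (v < V)%N%:R = \sum_(v < V) x ^+ v.
    rewrite (big_ord_widen _ (fun v => x ^+ v) VQ) [RHS]big_mkcond.
    by apply: eq_bigr => v _; case: ifP; rewrite ?mulr1 ?mulr0.
  by rewrite -[1 - x]opprB mulNr -subrX1 opprK addrC subrK.
rewrite (eq_bigr _ (fun u _ => geo _ (leq_div _ _))).
rewrite sumrB sumr_const card_ord -mulr_sumr exchange_big /=.
congr (_ - _ * _); apply: eq_bigr => v _.
rewrite -mulr_sumr; congr (_ * _); rewrite -natr_sum; congr (_%:R).
(* Both [v < Q %/ u.+1] and [u < Q %/ v.+1] mean [u.+1 * v.+1 <= Q]. *)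
transitivity (\sum_(u < Q) (u < Q %/ v.+1)%N)%N.
  by apply: eq_bigr => u _; rewrite !leq_divRL // mulnC.
rewrite -big_mkcond /= -(big_ord_widen _ (fun=> 1%N)) ?leq_div //.
by rewrite sum1_card card_ord.
Qed.

(** With [x = expR (- t)], the sum [A] is the series of [- ln (1 - x)] cut after [Q] terms, each
    [1 / v.+1] being lowered by at most [1 / Q]. Multiplied by [x^-1 - 1], the cut costs [x ^+ Q]
    and the lowering [1 / Q]. *)
Lemma pareto_mgf_expR_bounds (R : realType) (Q : nat) (t : R) :
  (0 < Q)%N -> 0 < t ->
  (expR t - 1) * ln (1 - expR (- t)) <= pareto_mgf Q t - 1 <=
  (expR t - 1) * ln (1 - expR (- t)) + expR (- (t * Q%:R)) + Q%:R^-1.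
Proof.
move=> Q_gt0 t_gt0; set x := expR (- t).
have x_gt0 : 0 < x by apply: expR_gt0.
have x_lt1 : x < 1 by rewrite expR_lt1 oppr_lt0.
have x1 : 0 < 1 - x by rewrite subr_gt0.
have Q0 : 0 < Q%:R :> R by rewrite ltr0n.
have Qn0 := lt0r_neq0 Q0; have xn0 := lt0r_neq0 x_gt0.
have x1n0 := lt0r_neq0 x1.
have xV : expR t = x^-1 by rewrite /x expRN invrK.
have xX k : expR (- (t * k%:R)) = x ^+ k by rewrite -mulNr expRM_natr.
rewrite xX xV.
pose A := \sum_(v < Q) x ^+ v.+1 * ((Q %/ v.+1)%:R / Q%:R).
have -> : pareto_mgf Q t - 1 = - ((x^-1 - 1) * A).
  rewrite /pareto_mgf (eq_bigr _ (fun u _ => xX _)) sum_expr_divn mulrBl.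
  rewrite divff // addrC addKr; congr (- _).
  have -> : A = x / Q%:R * \sum_(v < Q) x ^+ v * (Q %/ v.+1)%:R.
    rewrite /A mulr_sumr; apply: eq_bigr => v _; rewrite exprS; ring.
  by field; rewrite xn0 Qn0.
have /andP[lnl lnu] := ln_series_bounds Q (ltW x_gt0) x_lt1.
have xV1 : 0 <= x^-1 - 1 by rewrite subr_ge0 -xV ltW // expR_gt1.
have Aub : A <= - ln (1 - x).
  apply: le_trans lnu; apply: ler_sum => v _.
  apply: ler_wpM2l; first by rewrite exprn_ge0 ?ltW.
  rewrite ler_pdivrMr // ler_pdivlMl ?ltr0n // -natrM ler_nat mulnC.
  exact: leq_trunc_div.
have Alb : - ln (1 - x) - x ^+ Q.+1 / (1 - x) - x / (1 - x) / Q%:R <= A.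
  apply: (le_trans (lerB lnl (lexx _))).
  have -> : A = \sum_(v < Q) x ^+ v.+1 / v.+1%:R -
      \sum_(v < Q) x ^+ v.+1 * (v.+1%:R^-1 - (Q %/ v.+1)%:R / Q%:R).
    by rewrite -sumrB; apply: eq_bigr => v _; rewrite mulrBr subKr.
  apply: lerB => //; apply: (@le_trans _ _ (\sum_(v < Q) x ^+ v.+1 / Q%:R)).
    apply: ler_sum => v _; apply: ler_wpM2l; first by rewrite exprn_ge0 ?ltW.
    have v0 : 0 < v.+1%:R :> R by rewrite ltr0n.
    rewrite lerBlDr -[X in _ <= X + _]mul1r -mulrDl ler_pdivlMr //.
    rewrite ler_pdivrMl // nat1r -natrM ler_nat.
    by rewrite mulnC ltnW // -ltn_divLR.
  rewrite -mulr_suml ler_pM2r ?invr_gt0 //.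
  have -> : \sum_(v < Q) x ^+ v.+1 = x * \sum_(v < Q) x ^+ v.
    by rewrite mulr_sumr; apply: eq_bigr => v _; rewrite exprS.
  rewrite ler_pM2l // -[leRHS]mul1r ler_pdivlMr //.
  rewrite mulrC -opprB mulNr -subrX1 opprB gerBl exprn_ge0 // ltW //.
rewrite -mulrN.
apply/andP; split.
  by apply: ler_wpM2l => //; rewrite lerNr.
have := ler_wpM2l xV1 Alb.
rewrite [X in X <= _ -> _](_ : _ =
   - ((x^-1 - 1) * ln (1 - x) + x ^+ Q + Q%:R^-1)); last first.
  by rewrite exprS; field; rewrite x1n0 xn0 Qn0.
by rewrite mulrN lerNl.
Qed.

(** The bound on [Q] absorbs the discretization errors in the upper estimate. In the lower one the
    error divided by [t] is at most [t + 2 * (t * L) + 8 * (L * (t * L))] with [L = - ln t + t]. For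
    [r] the fourth root of [t], these terms are at most 1, 10 and 200 times [r ^+ 2], whence 211. *)
Lemma ln_pareto_mgf (R : realType) (Q : nat) (t eta : R) :
  0 < t -> 0 < eta -> eta <= 1 -> 2 <= eta * t ^+ 2 * Q%:R ->
  211 ^+ 2 * t <= eta ^+ 2 ->
  `|ln (pareto_mgf Q t) - t * ln t| <= eta * t.
Proof.
move=> t_gt0 eta_gt0 eta_le1 Qbig t_small.
have Q_gt0 : (0 < Q)%N.
  by case: Q Qbig => //; rewrite mulr0 leNgt ltr0n.
have t_le : t <= 1 / 2 by nra.
(* With a fourth root, [- ln r <= r^-1] bounds [t * L ^+ 2] by a multiple of [r ^+ 2], which still
   tends to 0. *)
pose r := Num.sqrt (Num.sqrt t).
have r_gt0 : 0 < r by rewrite !sqrtr_gt0.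
have r2 : r ^+ 2 = Num.sqrt t by rewrite sqr_sqrtr ?sqrtr_ge0.
have r4 : t = r ^+ 4 by rewrite (exprM r 2 2) r2 sqr_sqrtr // ltW.
have r2_small : 211 * r ^+ 2 <= eta.
  have : (211 * r ^+ 2) ^+ 2 <= eta ^+ 2 by rewrite exprMn -exprM -r4.
  by rewrite ler_pXn2r // nnegrE ?mulr_ge0 ?exprn_ge0 // ltW.
have r_le1 : r <= 1 / 14 by nra.
have /andP[Gl Gu] := pareto_mgf_expR_bounds Q_gt0 t_gt0.
set G := pareto_mgf Q t in Gl Gu *.
have et_ge : t <= expR t - 1 by have := expR_ge1Dx t; lra.
have em_ge : 1 - t <= expR (- t) by apply: expR_ge1Dx.
have et_le : expR t - 1 <= t + 2 * t ^+ 2.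
  have : expR t * (1 - t) <= 1.
    by rewrite -[leRHS](expRxMexpNx_1 t) ler_pM2l ?expR_gt0.
  have := expR_gt0 t; nra.
have em1 : 0 < 1 - expR (- t) by rewrite subr_gt0 expR_lt1 oppr_lt0.
have lnt_le0 : ln t <= 0 by apply: ln_le0; lra.
have ln_ub : ln (1 - expR (- t)) <= ln t by rewrite ler_ln ?posrE //; lra.
have ln_lb : ln t - t <= ln (1 - expR (- t)).
  have -> : ln t - t = ln (t * expR (- t)).
    by rewrite lnM ?posrE ?expR_gt0 // expRK.
  rewrite ler_ln ?posrE ?mulr_gt0 ?expR_gt0 //.
  have := expR_gt0 (- t); have := expRxMexpNx_1 t; nra.
have lntE : ln t = 4 * ln r.
  by rewrite {1}r4 lnXn // mulr_natl.
have lnr : - ln r <= r^-1.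
  rewrite -lnV ?posrE //; apply/ltW/ln_sublinear; by rewrite invr_gt0.
have Lr : (- ln t + t) * r <= 5.
  have rr : r^-1 * r = 1 by rewrite mulVf ?lt0r_neq0.
  have : - ln t * r <= 4 by rewrite lntE; nra.
  have : t * r <= 1 by nra.
  lra.
set L := - ln t + t in Lr.
have L_gt0 : 0 < L by rewrite /L; lra.
pose y := (expR t - 1) * L.
have y_ge0 : 0 <= y by rewrite /y mulr_ge0 //; lra.
have tL : t * L <= 5 * r ^+ 3.
  by rewrite r4 exprSr -mulrA mulrC ler_pM2r ?exprn_gt0 // mulrC.
have y_ub : y <= t * L + 2 * t * (t * L) by rewrite /y; nra.
have r3 : r ^+ 3 <= r ^+ 2 / 14 by rewrite exprSr ler_pM2l ?exprn_gt0 //; lra.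
have r22 : r ^+ 2 <= 1 / 196 by rewrite expr2; nra.
have tL0 : 0 <= t * L by rewrite mulr_ge0 // ltW.
have y_ub2 : y <= 2 * (t * L) by nra.
have y_half : y <= 1 / 2 by nra.
have et_ge0 : 0 <= expR t - 1 by lra.
have Gly : 1 - y <= G.
  have := ler_wpM2l et_ge0 ln_lb; rewrite (_ : ln t - t = - L); last first.
    by rewrite /L; ring.
  by rewrite mulrN -/y; lra.
have G_gt0 : 0 < G by lra.
have lnG_lb : - y - 2 * y ^+ 2 <= ln G.
  apply: (@le_trans _ _ (ln (1 - y))); last by rewrite ler_ln ?posrE //; lra.
  have y1 : 0 < 1 - y by lra.
  rewrite -[ln _]opprK -lnV ?posrE // lerNr.
  have -> : (1 - y)^-1 = 1 + y / (1 - y) by field; apply: lt0r_neq0.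
  have yq : 0 <= y / (1 - y) by rewrite divr_ge0 // ltW.
  apply: (le_trans (le_ln1Dx _)); first by apply: lt_le_trans yq; lra.
  rewrite ler_pdivrMr //; nra.
have lnG_ub : ln G <= G - 1.
  by rewrite -{1}[G](subrK 1) addrC; apply: le_ln1Dx; lra.
rewrite ler_norml; apply/andP; split; last first.
  have Q0 : 0 < Q%:R :> R by rewrite ltr0n.
  have eQ : expR (- (t * Q%:R)) <= (t * Q%:R)^-1.
    rewrite expRN lef_pV2 ?posrE ?expR_gt0 ?mulr_gt0 //.
    by have := expR_ge1Dx (t * Q%:R); lra.
  have QV : Q%:R^-1 <= (t * Q%:R)^-1.
    rewrite lef_pV2 ?posrE ?mulr_gt0 //; nra.
  have QV2 : 2 * (t * Q%:R)^-1 <= eta * t.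
    rewrite ler_pdivrMr ?mulr_gt0 //.
    by apply: (le_trans Qbig); rewrite expr2 !mulrA.
  have : (expR t - 1) * ln (1 - expR (- t)) <= t * ln t by nra.
  lra.
have y2_ub : 2 * y ^+ 2 <= 8 * t * (L * (t * L)).
  have -> : 8 * t * (L * (t * L)) = 2 * (2 * (t * L)) ^+ 2 by ring.
  by rewrite ler_pM2l // lerXn2r // nnegrE //; lra.
have LtL : L * (t * L) <= 25 * r ^+ 2.
  have -> : L * (t * L) = (L * r) ^+ 2 * r ^+ 2 by rewrite r4; ring.
  rewrite ler_pM2r ?exprn_gt0 //; rewrite expr2; have := mulr_gt0 L_gt0 r_gt0; nra.
have tr : t <= r ^+ 2 by rewrite r4 (exprM r 2 2) expr2; have := exprn_gt0 2 r_gt0; nra.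
have main : t + 2 * (t * L) + 8 * (L * (t * L)) <= eta by lra.
have -> : ln t = t - L by rewrite /L; ring.
nra.
Qed.

(** * Unbiased floating point counters *)

Definition mean (R : realType) (T : finType) (f : T -> R) : R :=
  (\sum_x f x) / #|T|%:R.

(* Floating point numbers with [b.+1] bits of mantissa: near [x] the representable
   values are the multiples of [2 ^ cexp b E x].  Adding a uniform dither [u]
   before truncating makes the rounding unbiased. *)
Definition cexp (b E x : nat) : nat := minn E (trunc_log 2 x - b).

Definition rnd (b E u x : nat) : nat :=
  ((x + u %% 2 ^ cexp b E x) %/ 2 ^ cexp b E x * 2 ^ cexp b E x)%N.

Lemma leq_cexp b E : {homo cexp b E : x y / (x <= y)%N}.
Proof. by move=> x y xy; have := leq_trunc_log 2 xy; rewrite /cexp; lia. Qed.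

Lemma expn_cexp b E x : (0 < cexp b E x)%N -> (2 ^ (cexp b E x + b) <= x)%N.
Proof.
move=> e0; have x0 : (0 < x)%N by case: x e0 => //; rewrite /cexp trunc_log0; lia.
apply: leq_trans (trunc_logP (isT : 1 < 2)%N x0).
by rewrite leq_exp2l //; move: e0; rewrite /cexp; lia.
Qed.

Lemma rnd_split b E u x : let g := (2 ^ cexp b E x)%N in
  rnd b E u x = (x %/ g * g + (g - x %% g <= u %% g)%N * g)%N.
Proof.
rewrite /rnd; set g := (2 ^ _)%N => /=.
have g0 : (0 < g)%N by rewrite expn_gt0.
have rg : (x %% g < g)%N by rewrite ltn_mod.
have ug : (u %% g < g)%N by rewrite ltn_mod.
rewrite {1}(divn_eq x g) -addnA divnMDl // mulnDl; congr (_ + _ * _)%N.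
case: leqP => h.
  rewrite (_ : x %% g + u %% g = 1 * g + (x %% g + u %% g - g))%N; last by lia.
  by rewrite divnMDl // divn_small //; lia.
by rewrite divn_small //; lia.
Qed.

Lemma sum_modn (R : realType) (F : nat -> R) (K g : nat) : (0 < g)%N ->
  \sum_(0 <= u < K * g) F (u %% g)%N = K%:R * \sum_(0 <= d < g) F d.
Proof.
move=> g0; elim: K => [|K IH]; first by rewrite mul0n big_geq // mul0r.
rewrite mulSn addnC (@big_cat_nat _ _ _ (K * g)%N) ?leq_addr //= IH.
rewrite -natr1 mulrDl mul1r; congr (_ + _).
rewrite -{1}[(K * g)%N]add0n big_addn addKn.
rewrite !big_nat; apply: eq_bigr => d /andP[_ dg].
by rewrite addnC modnMDl modn_small.
Qed.

(** Since the exponent is capped at [E], the spacing divides [2 ^ E], so the dither is exactly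
    uniform modulo [g]. *)
Lemma sum_rnd (R : realType) (F : nat -> R) b E x :
  let g := (2 ^ cexp b E x)%N in let lo := (x %/ g * g)%N in
  \sum_(u < 2 ^ E) F (rnd b E u x) =
  (2 ^ (E - cexp b E x))%:R *
    ((g - x %% g)%:R * F lo + (x %% g)%:R * F (lo + g)%N).
Proof.
move=> g lo.
have g0 : (0 < g)%N by rewrite expn_gt0.
have rg : (x %% g < g)%N by rewrite ltn_mod.
pose F' d := F (lo + (g - x %% g <= d)%N * g)%N.
rewrite -(big_mkord xpredT (fun u => F (rnd b E u x))).
rewrite (eq_bigr (fun u => F' (u %% g)%N)); last by move=> u _; rewrite rnd_split.
have -> : (2 ^ E = 2 ^ (E - cexp b E x) * g)%N.
  by rewrite -expnD subnK // geq_minl.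
rewrite sum_modn //; congr (_ * _).
rewrite (@big_cat_nat _ _ _ (g - x %% g)%N) ?leq_subr //=; congr (_ + _).
  rewrite big_nat (eq_bigr (fun=> F lo)); last first.
    by move=> d /andP[_ dg]; rewrite /F' leqNgt dg mul0n addn0.
  by rewrite -big_nat sumr_const_nat subn0 mulr_natl.
rewrite big_nat (eq_bigr (fun=> F (lo + g)%N)); last first.
  by move=> d /andP[dg _]; rewrite /F' dg mul1n.
by rewrite -big_nat sumr_const_nat subKn ?mulr_natl // ltnW.
Qed.

Section RndMoments.
Variables (R : realType) (b E : nat).

Let natr_mod x g : (x %/ g * g)%:R = x%:R - (x %% g)%:R :> R.
Proof. by rewrite {2}(divn_eq x g) natrD addrK. Qed.

Let card_split x : (2 ^ E)%:R = (2 ^ (E - cexp b E x))%:R * (2 ^ cexp b E x)%:R :> R.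
Proof. by rewrite -natrM -expnD subnK // geq_minl. Qed.

Lemma mean_rnd x : mean (fun u : 'I_(2 ^ E) => (rnd b E u x)%:R) = x%:R :> R.
Proof.
rewrite /mean (sum_rnd (fun y => y%:R)) card_ord (card_split x).
set g := (2 ^ cexp b E x)%N; set h := (2 ^ _)%:R.
have rg : (x %% g < g)%N by rewrite ltn_mod expn_gt0.
have g0 : g%:R != 0 :> R by rewrite pnatr_eq0 -lt0n expn_gt0.
have h0 : h != 0 by rewrite pnatr_eq0 -lt0n expn_gt0.
rewrite natrD natr_mod natrB 1?ltnW //; field.
by rewrite h0 g0.
Qed.

Lemma mean_rnd_var x :
  mean (fun u : 'I_(2 ^ E) => ((rnd b E u x)%:R - x%:R) ^+ 2) =
  (x %% 2 ^ cexp b E x)%:R * (2 ^ cexp b E x - x %% 2 ^ cexp b E x)%:R :> R.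
Proof.
rewrite /mean (sum_rnd (fun y => (y%:R - x%:R) ^+ 2)) card_ord (card_split x).
set g := (2 ^ cexp b E x)%N; set h := (2 ^ _)%:R.
have rg : (x %% g < g)%N by rewrite ltn_mod expn_gt0.
have g0 : g%:R != 0 :> R by rewrite pnatr_eq0 -lt0n expn_gt0.
have h0 : h != 0 by rewrite pnatr_eq0 -lt0n expn_gt0.
rewrite natrD natr_mod natrB 1?ltnW //; field.
by rewrite h0 g0.
Qed.

(* When [v] is representable, the grid point below [v + a] is at least [v]: at most
   [a] is rounded off, which is what keeps the variance proportional to [a]. *)
Definition representable v := (2 ^ cexp b E v %| v)%N.

(** If the spacing does not change from [v] to [v + a], then [v] is itself a grid point. Otherwise a
    power of two lies between them that is a multiple of the new spacing. *)
Lemma leq_grid v a : representable v ->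
  (v <= (v + a) %/ 2 ^ cexp b E (v + a) * 2 ^ cexp b E (v + a))%N.
Proof.
move=> rv; have := leq_cexp b E (leq_addr a v).
rewrite leq_eqVlt => /orP[/eqP <-|lt_e].
  rewrite {1}(divn_eq v (2 ^ cexp b E v)) (eqP rv) addn0.
  by rewrite leq_mul2r leq_div2r ?orbT ?leq_addr.
have le2 : (2 ^ (cexp b E (v + a) + b) <= v + a)%N by apply: expn_cexp; lia.
have ltv : (v < 2 ^ (cexp b E (v + a) + b))%N.
  case: v {rv} lt_e le2 => [|v] lt_e le2; first by rewrite expn_gt0.
  have /andP[_ h] := trunc_log_bounds (isT : 1 < 2)%N (ltn0Sn v).
  apply: (leq_trans h); rewrite leq_exp2l //.
  by move: lt_e; rewrite {1}/cexp; have := geq_minl E (trunc_log 2 (v.+1 + a) - b);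
     rewrite -/(cexp b E (v.+1 + a)); lia.
rewrite expnD mulnC in le2 ltv.
apply: (leq_trans (ltnW ltv)); rewrite leq_mul2r; apply/orP; right.
by rewrite leq_divRL ?expn_gt0.
Qed.

(** The spacing at the rounded value can exceed that at [x] only if rounding up reaches the next
    power of two. The value is then that power, which the coarser spacing divides too. *)
Lemma rnd_representable u x : representable (rnd b E u x).
Proof.
rewrite /representable; set y := rnd b E u x; set e := cexp b E x.
have ey : (2 ^ e %| y)%N by rewrite /y /rnd dvdn_mull.
have [le|lt] := leqP (cexp b E y) e.
  by apply: dvdn_trans ey; rewrite dvdn_exp2l.
have e_lt_E : (e < E)%N by apply: leq_trans lt _; rewrite geq_minl.
have yub : (y <= 2 ^ (e.+1 + b))%N.
  have [x0|x0] := posnP x.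
    by rewrite /y x0 rnd_split mod0n div0n subn0 [(_ <= _ %% _)%N]leqNgt ltn_mod expn_gt0.
  have /andP[_ h] := trunc_log_bounds (isT : 1 < 2)%N x0.
  have hx : (x < 2 ^ (e.+1 + b))%N.
    apply: (leq_trans h); rewrite leq_exp2l //.
    by move: e_lt_E; rewrite /e /cexp; lia.
  have pE : (2 ^ (e.+1 + b) = 2 * 2 ^ b * 2 ^ e)%N by rewrite expnD expnS mulnAC.
  rewrite pE in hx; rewrite pE.
  have q : (x %/ 2 ^ e < 2 * 2 ^ b)%N by rewrite ltn_divLR ?expn_gt0.
  rewrite /y rnd_split -mulnDl leq_mul2r; apply/orP; right.
  by case: (_ <= _ %% _)%N; rewrite ?addn1 ?addn0 // ltnW.
have := @expn_cexp b E y (leq_ltn_trans (leq0n _) lt) => ylb.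
have le2 : (2 ^ (e.+1 + b) <= 2 ^ (cexp b E y + b))%N by rewrite leq_exp2l // leq_add2r.
have -> : y = (2 ^ (cexp b E y + b))%N.
  by apply/eqP; rewrite eqn_leq ylb (leq_trans yub).
rewrite [X in (2 ^ cexp b E X)%N](_ : _ = y); last first.
  by apply/esym/eqP; rewrite eqn_leq ylb (leq_trans yub).
by rewrite dvdn_exp2l // leq_addr.
Qed.

Lemma leq_rnd u v a : representable v -> (v <= rnd b E u (v + a))%N.
Proof. by move=> rv; rewrite rnd_split (leq_trans (leq_grid a rv)) ?leq_addr. Qed.

(** The variance is [r * (g - r)] for the remainder [r]. By [leq_grid], [r <= a], and a spacing
    above 1 satisfies [g * 2 ^ b <= v + a]. *)
Lemma mean_rnd_var_le v a : representable v ->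
  mean (fun u : 'I_(2 ^ E) => ((rnd b E u (v + a))%:R - (v + a)%:R) ^+ 2) <=
  a%:R * (v + a)%:R / 2 ^+ b :> R.
Proof.
move=> rv; rewrite mean_rnd_var; set g := (2 ^ _)%N.
rewrite ler_pdivlMr ?exprn_gt0 // -natrX -!natrM ler_nat.
have [e0|e1] := posnP (cexp b E (v + a)).
  by rewrite /g e0 expn0 modn1 !mul0n.
have := expn_cexp e1; rewrite expnD -/g => le2.
have := leq_grid a rv; rewrite -/g => le3.
have r_le : ((v + a) %% g <= a)%N by have := divn_eq (v + a) g; lia.
by rewrite -mulnA leq_mul // (leq_trans _ le2) // leq_mul2r leq_subr orbT.
Qed.

End RndMoments.

(** * Averages over finite uniform spaces *)

Section Mean.
Variable R : realType.
Implicit Types T : finType.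

Lemma eq_mean T (f g : T -> R) : f =1 g -> mean f = mean g.
Proof. by move=> fg; rewrite /mean (eq_bigr _ (fun x _ => fg x)). Qed.

Lemma meanD T (f g : T -> R) : mean (fun x => f x + g x) = mean f + mean g.
Proof. by rewrite /mean big_split mulrDl. Qed.

Lemma meanZ T (a : R) (f : T -> R) : mean (fun x => a * f x) = a * mean f.
Proof. by rewrite /mean -mulr_sumr mulrA. Qed.

Lemma meanN T (f : T -> R) : mean (fun x => - f x) = - mean f.
Proof. by rewrite /mean sumrN mulNr. Qed.

Lemma mean_cst T (x : T) (a : R) : mean (fun _ : T => a) = a.
Proof.
rewrite /mean sumr_const -[_ *+ _]mulr_natr mulfK // pnatr_eq0 -lt0n.
by apply/card_gt0P; exists x.
Qed.

Lemma mean_sum T (I : finType) (f : I -> T -> R) :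
  mean (fun x => \sum_i f i x) = \sum_i mean (f i).
Proof. by rewrite /mean exchange_big /= mulr_suml. Qed.

Lemma ler_mean T (f g : T -> R) : (forall x, f x <= g x) -> mean f <= mean g.
Proof.
by move=> fg; rewrite ler_wpM2r ?invr_ge0 ?ler0n //; apply: ler_sum.
Qed.

Lemma mean_pair T T' (f : T * T' -> R) :
  mean f = mean (fun x => mean (fun y => f (x, y))).
Proof.
rewrite /mean -mulr_suml -mulrA -invfM card_prod natrM mulrC [X in _ / X]mulrC.
by rewrite mulrC; congr (_ / _); rewrite pair_big; apply: eq_bigr => -[].
Qed.

Lemma mean_tuple0 T (f : seq T -> R) :
  mean (fun t : 0.-tuple T => f t) = f [::].
Proof.
rewrite (eq_mean (g := fun=> f [::])); first exact: (mean_cst [tuple]).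
by move=> t; rewrite tuple0.
Qed.

Lemma mean_tupleS T k (f : seq T -> R) :
  mean (fun t : k.+1.-tuple T => f t) =
  mean (fun x => mean (fun t : k.-tuple T => f (x :: t))).
Proof.
rewrite -(mean_pair (fun p : T * k.-tuple T => f (p.1 :: p.2))) /mean.
rewrite card_prod !card_tuple expnS; congr (_ / _).
rewrite (reindex (fun p : T * k.-tuple T => [tuple of p.1 :: p.2])) //=.
exists (fun t => (thead t, [tuple of behead t])) => [[x t]|t] _ /=.
  by congr (_, _); apply: val_inj.
by rewrite -tuple_eta.
Qed.

End Mean.

Section Counter.
Variables (R : realType) (U : Type) (b E : nat) (w : U -> nat).

Definition approx_count (v : nat) (s : seq U) (cs : seq 'I_(2 ^ E)) : nat :=
  foldl (fun v (uc : U * 'I_(2 ^ E)) => rnd b E uc.2 (v + w uc.1)) v (zip s cs).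

Lemma mean_approx_count k v s : size s = k ->
  mean (fun t : k.-tuple _ => (approx_count v s t)%:R) = (v + \sum_(x <- s) w x)%:R :> R.
Proof.
elim: k v s => [|k IH] v [|a s] //= => [_|[sk]].
  by rewrite (mean_tuple0 (fun t => (approx_count v [::] t)%:R)) big_nil addn0.
rewrite (mean_tupleS _ (fun t => (approx_count v (a :: s) t)%:R)) /=.
rewrite (eq_mean (fun c => IH _ s sk)).
under eq_mean do rewrite natrD.
rewrite meanD /= mean_rnd (mean_cst (Ordinal (expn_gt0 2 E : 0 < _)%N)).
by rewrite big_cons addnA [in RHS]natrD.
Qed.

(** The counter error is a martingale, so the variances of the roundings add up. The bound is affine
    in the starting value and can therefore be averaged over the first rounding, which is
    unbiased. *)
Lemma mean_approx_count_var k v s : size s = k -> representable b E v ->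
  mean (fun t : k.-tuple _ =>
    ((approx_count v s t)%:R - (v + \sum_(x <- s) w x)%:R) ^+ 2) <=
  (\sum_(x <- s) w x)%:R * (v + \sum_(x <- s) w x)%:R / 2 ^+ b :> R.
Proof.
elim: k v s => [|k IH] v [|a s] //= => [_|[sk]] rv.
  rewrite (mean_tuple0 (fun t => ((approx_count v [::] t)%:R - _) ^+ 2)) big_nil addn0.
  by rewrite subrr expr0n /= !mul0r.
set W := (\sum_(x <- s) w x)%N.
have WE : (\sum_(x <- a :: s) w x = w a + W)%N by rewrite big_cons.
rewrite WE.
rewrite (mean_tupleS _ (fun t => ((approx_count v (a :: s) t)%:R - _) ^+ 2)) /=.
set y := fun c : 'I_(2 ^ E) => rnd b E c (v + w a).
have step c :
    mean (fun t : k.-tuple 'I_(2 ^ E) =>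
      ((approx_count v (a :: s) (c :: t))%:R - (v + (w a + W))%:R) ^+ 2) =
    mean (fun t : k.-tuple 'I_(2 ^ E) =>
      ((approx_count (y c) s t)%:R - (y c + W)%:R) ^+ 2) +
    ((y c)%:R - (v + w a)%:R) ^+ 2 :> R.
  (* The square is expanded around the total that follows the first rounding; the cross term has
     mean zero. *)
  pose d : R := (y c)%:R - (v + w a)%:R.
  rewrite (eq_mean (g := fun t : k.-tuple _ =>
     ((approx_count (y c) s t)%:R - (y c + W)%:R) ^+ 2 +
     (2 * d * (approx_count (y c) s t)%:R + (d ^+ 2 - 2 * d * (y c + W)%:R)))); last first.
    move=> t; rewrite /approx_count /= -/(y c) -/(approx_count (y c) s t) /d !natrD; ring.
  rewrite meanD meanD meanZ (mean_approx_count _ sk).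
  rewrite (mean_cst [tuple of nseq k c]) -/d; ring.
rewrite (eq_mean step) meanD.
have le1 : mean (fun c => mean (fun t : k.-tuple 'I_(2 ^ E) =>
      ((approx_count (y c) s t)%:R - (y c + W)%:R) ^+ 2)) <=
    W%:R * (v + w a + W)%:R / 2 ^+ b :> R.
  apply: (@le_trans _ _ (mean (fun c => W%:R * (y c + W)%:R / 2 ^+ b))).
    by apply: ler_mean => c; apply: (IH _ _ sk); apply: rnd_representable.
  under eq_mean do rewrite mulrAC natrD.
  rewrite meanZ meanD mean_rnd (mean_cst (Ordinal (expn_gt0 2 E : 0 < _)%N)).
  by rewrite -natrD mulrAC.
apply: (le_trans (lerD le1 (mean_rnd_var_le R _ rv))).
rewrite -mulrDl ler_pM2r ?invr_gt0 ?exprn_gt0 // -!natrM -natrD ler_nat.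
by rewrite -addnA !mulnDr mulnDl mulnDl; nia.
Qed.

(** Needed for streams of total 0, where the answer has to be exact for all coins. *)
Lemma approx_count0 v s cs : (\sum_(x <- s) w x = 0)%N ->
  representable b E v -> approx_count v s cs = v.
Proof.
elim: s v cs => [|a s IH] v [|c cs] //=.
rewrite big_cons => /eqP; rewrite addn_eq0 => /andP[/eqP wa /eqP ws] rv.
have rv0 : rnd b E c (v + w a) = v.
  rewrite wa addn0 rnd_split (eqP rv : v %% _ = 0)%N subn0.
  by rewrite [(_ <= _ %% _)%N]leqNgt ltn_mod expn_gt0 /= addn0 divnK.
by rewrite /approx_count /= rv0 -/(approx_count v s cs) IH.
Qed.

Lemma leq_approx_count v s cs : representable b E v -> (v <= approx_count v s cs)%N.
Proof.
elim: s v cs => [|a s IH] v [|c cs] //= rv.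
apply: (leq_trans (leq_rnd c (w a) rv)).
by apply: (IH _ cs); apply: rnd_representable.
Qed.

End Counter.

(** * Mean and variance of the sketch *)

Lemma big_pairE (S : Type) (idx : S) (op : Monoid.com_law idx) (I J : finType)
    (F : I * J -> S) :
  \big[op/idx]_p F p = \big[op/idx]_i \big[op/idx]_j F (i, j).
Proof. by rewrite pair_big; apply: eq_bigr => -[]. Qed.

Section MeanFfun.
Variables (R : realType) (I T : finType).

Lemma mean_prod_ffun (f : I -> T -> R) :
  mean (fun w : {ffun I -> T} => \prod_i f i (w i)) = \prod_i mean (f i).
Proof.
by rewrite /mean -bigA_distr_bigA prodf_div prodr_const card_ffun natrX.
Qed.

Variable x0 : T.

Lemma mean_ffun1 (f : T -> R) (j : I) :
  mean (fun w : {ffun I -> T} => f (w j)) = mean f.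
Proof.
transitivity (mean (fun w : {ffun I -> T} =>
    \prod_i (if i == j then f (w i) else 1))).
  by apply: eq_mean => w; rewrite -big_mkcond big_pred1_eq.
rewrite (mean_prod_ffun (fun i x => if i == j then f x else 1)) (bigD1 j) //=.
rewrite eqxx big1 ?mulr1 // => i /negbTE ->; exact: (mean_cst x0).
Qed.

Lemma mean_ffun2 (f g : T -> R) (j l : I) : j != l ->
  mean (fun w : {ffun I -> T} => f (w j) * g (w l)) = mean f * mean g.
Proof.
move=> jl; pose F i x := (if i == j then f x else 1) * (if i == l then g x else 1).
transitivity (mean (fun w : {ffun I -> T} => \prod_i F i (w i))).
  apply: eq_mean => w; rewrite /F big_split -!big_mkcond.
  by rewrite !big_pred1_eq.
rewrite mean_prod_ffun (bigD1 j) // (bigD1 l) 1?eq_sym //= mulrA.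
rewrite [X in _ * X]big1 ?mulr1; last first.
  move=> i /andP[/negbTE ij /negbTE il]; rewrite /F ij il mulr1; exact: (mean_cst x0).
rewrite /F eqxx (negbTE jl) eq_sym (negbTE jl) eqxx.
by congr (_ * _); apply: eq_mean => x; rewrite ?mulr1 ?mul1r.
Qed.

(** Independence kills the cross terms of the centred values, and a variance is at most the second
    moment. *)
Lemma mean_avg_var (g : T -> R) : (0 < #|I|)%N ->
  mean (fun w : {ffun I -> T} => ((\sum_j g (w j)) / #|I|%:R - mean g) ^+ 2) <=
  mean (fun x => g x ^+ 2) / #|I|%:R.
Proof.
move=> I0; have Jn0 : #|I|%:R != 0 :> R by rewrite pnatr_eq0 -lt0n.
pose h x := g x - mean g.
have mh : mean h = 0 by rewrite /h meanD (mean_cst x0) subrr.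
have vh : mean (fun x => h x ^+ 2) <= mean (fun x => g x ^+ 2).
  have -> : mean (fun x => h x ^+ 2) = mean (fun x => g x ^+ 2) - mean g ^+ 2.
    rewrite (eq_mean (g := fun x => g x ^+ 2 + (- (2 * mean g) * g x + mean g ^+ 2))).
      by rewrite meanD meanD meanZ (mean_cst x0); ring.
    by move=> x; rewrite /h; ring.
  by rewrite gerBl sqr_ge0.
rewrite (eq_mean (g := fun w : {ffun I -> T} =>
    (#|I|%:R ^+ 2)^-1 * \sum_j \sum_l h (w j) * h (w l))); last first.
  move=> w; rewrite -big_distrlr /= /h sumrB sumr_const -[_ *+ _]mulr_natl.
  by field.
rewrite meanZ mean_sum (eq_bigr (fun=> mean (fun x => h x ^+ 2))); last first.
  move=> j _; rewrite mean_sum (bigD1 j) //= big1 ?addr0.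
    exact: (mean_ffun1 (fun x => h x ^+ 2)).
  by move=> l lj; rewrite mean_ffun2 1?eq_sym // mh mul0r.
rewrite sumr_const -(mulr_natl (mean _)) mulrA expr2 invfM mulfVK //.
by rewrite mulrC ler_pM2r // invr_gt0 ltr0n.
Qed.

End MeanFfun.

Section Sketch.
Variables (R : realType) (n N Q : nat) (x : 'I_n -> nat).

(** The [r_i] of the overview: each [Q %/ u.+1] is one discrete Pareto copy. *)
Definition weight (w : {ffun 'I_n * 'I_N -> 'I_Q}) (i : 'I_n) : nat :=
  (\sum_(t < N) Q %/ (w (i, t)).+1)%N.

Let F := (\sum_i x i)%N.

Definition nat_entropy : R :=
  - \sum_i (x i)%:R / F%:R * ln ((x i)%:R / F%:R).

Definition sketch (w : {ffun 'I_n * 'I_N -> 'I_Q}) : R :=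
  (\sum_i x i * weight w i)%:R / (N%:R * F%:R).

Lemma mean_expR_sketch (s : R) :
  mean (fun w => expR (- (s * sketch w))) =
  \prod_i pareto_mgf Q (s * (x i)%:R / (F%:R * N%:R)) ^+ N.
Proof.
pose f (it : 'I_n * 'I_N) (u : 'I_Q) : R :=
  expR (- (s * (x it.1)%:R / (F%:R * N%:R) * (Q %/ u.+1)%:R)).
rewrite (eq_mean (g := fun w : {ffun _ -> _} => \prod_it f it (w it))); last first.
  move=> w; rewrite /f -expR_sum; congr expR; rewrite sumrN; congr (- _).
  rewrite big_pairE /sketch natr_sum mulr_suml mulr_sumr.
  apply: eq_bigr => i _ /=; rewrite -mulr_sumr /weight natrM natr_sum.
  by rewrite [F%:R * _]mulrC; ring.
rewrite mean_prod_ffun /f big_pairE.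
apply: eq_bigr => i _; rewrite /= prodr_const card_ord; congr (_ ^+ _).
by rewrite /mean card_ord.
Qed.

Lemma pareto_mgf_gt0 (t : R) : (0 < Q)%N -> 0 < pareto_mgf Q t.
Proof.
move=> Q0; rewrite divr_gt0 ?ltr0n //.
rewrite (bigD1 (Ordinal Q0)) //= ltr_pwDl ?expR_gt0 // sumr_ge0 // => u _.
exact: expR_ge0.
Qed.

(** The logarithm of factor [i] is about [N * t i * ln (t i)] with [t i = s * p i / N]; the errors
    [s * (eta * p i)] add up to [s * eta]. A large [N] makes every [t i] small, and a large [Q]
    copes with [t i] as low as [1 / (F * N)]. The values [s = 1] and [s = 2] serve the first and
    second moments. *)
Lemma mean_expR_sketch_bounds (s eta : R) :
  (0 < F)%N -> 0 < eta -> eta <= 1 -> 1 <= s -> s <= 2 ->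
  2 * (F%:R * N%:R) ^+ 2 <= eta * Q%:R -> 2 * 211 ^+ 2 <= eta ^+ 2 * N%:R ->
  forall A, A = s * (ln s - ln N%:R - nat_entropy) ->
  expR (A - s * eta) <= mean (fun w => expR (- (s * sketch w))) <=
  expR (A + s * eta).
Proof.
move=> F0 eta0 eta1 s1 s2 hQ hN A AE0.
have N0 : (0 < N)%N by case: N hN => //; rewrite mulr0; lra.
have FN0 : 0 < F%:R * N%:R :> R by rewrite mulr_gt0 ?ltr0n.
have Q0 : (0 < Q)%N.
  case: Q hQ => //; rewrite mulr0; have := exprn_gt0 2 FN0; lra.
have Fr : 0 < F%:R :> R by rewrite ltr0n.
have Nr : 0 < N%:R :> R by rewrite ltr0n.
pose p i : R := (x i)%:R / F%:R.
have sump : \sum_i p i = 1.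
  by rewrite -mulr_suml -natr_sum divff // lt0r_neq0.
pose t i := s * (x i)%:R / (F%:R * N%:R).
have tE i : N%:R * t i = s * p i.
  by rewrite /t /p; field; rewrite !lt0r_neq0.
rewrite mean_expR_sketch.
have -> : \prod_i pareto_mgf Q (s * (x i)%:R / (F%:R * N%:R)) ^+ N =
    expR (\sum_i N%:R * ln (pareto_mgf Q (t i))).
  rewrite expR_sum; apply: eq_bigr => i _.
  by rewrite expRM_natl lnK // posrE pareto_mgf_gt0.
have AE : A = \sum_i s * (p i * (ln s - ln N%:R + ln (p i))).
  rewrite -mulr_sumr AE0 /nat_entropy opprK; congr (_ * _).
  by under [RHS]eq_bigr do rewrite mulrDr; rewrite big_split /= -mulr_suml sump mul1r.
have etaE : s * eta = \sum_i s * (eta * p i).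
  by rewrite -!mulr_sumr sump mulr1.
have key i : `|N%:R * ln (pareto_mgf Q (t i)) -
    s * (p i * (ln s - ln N%:R + ln (p i)))| <= s * (eta * p i).
  (* A zero coordinate contributes exactly 0 to both sums, the moment generating function at 0 being
     1. *)
  have [x0|x1] := posnP (x i).
    rewrite /t /p x0 mul0r mulr0 !mul0r !mulr0 subr0 /pareto_mgf.
    under eq_bigr do rewrite mul0r oppr0 expR0.
    by rewrite sumr_const card_ord divff ?ln1 ?mulr0 ?normr0 // pnatr_eq0 -lt0n.
  have xr : 1 <= (x i)%:R :> R by rewrite ler1n.
  have xF : (x i)%:R <= F%:R :> R by rewrite ler_nat /F (bigD1 i) //= leq_addr.
  have p0 : 0 < p i by rewrite divr_gt0 // ltr0n.
  have p1 : p i <= 1 by rewrite ler_pdivrMr // mul1r.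
  have t0 : 0 < t i by rewrite divr_gt0 // mulr_gt0 ?ltr0n //; lra.
  have s0 : 0 < s by lra.
  have lnt : ln (t i) = ln s - ln N%:R + ln (p i).
    have -> : t i = s / N%:R * p i by rewrite /t /p; field; rewrite !lt0r_neq0.
    by rewrite -ln_div ?posrE // lnM // posrE divr_gt0.
  have -> : N%:R * ln (pareto_mgf Q (t i)) -
      s * (p i * (ln s - ln N%:R + ln (p i))) =
      N%:R * (ln (pareto_mgf Q (t i)) - t i * ln (t i)).
    by rewrite mulrBr [N%:R * (_ * _)]mulrA tE lnt; ring.
  have -> : s * (eta * p i) = N%:R * (eta * t i).
    by rewrite mulrCA -tE; ring.
  rewrite normrM ger0_norm ?ler0n // ler_pM2l //.
  apply: ln_pareto_mgf => //.
    have t_lb : (F%:R * N%:R)^-1 <= t i.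
      by rewrite -[leLHS]mul1r ler_pM2r ?invr_gt0 //; nra.
    have : 1 <= (t i * (F%:R * N%:R)) ^+ 2.
      by rewrite exprn_ege1 // -ler_pdivrMr // mul1r.
    rewrite exprMn => h.
    apply: (@le_trans _ _ (2 * (t i ^+ 2 * (F%:R * N%:R) ^+ 2))); first by lra.
    rewrite mulrCA; apply: (le_trans (ler_wpM2l _ hQ)); first exact: sqr_ge0.
    by rewrite mulrA [_ * eta]mulrC.
  have tN : t i * N%:R <= 2 by rewrite mulrC tE; nra.
  rewrite -(ler_pM2r Nr); apply: le_trans hN.
  by lra.
have le1 : `|\sum_i N%:R * ln (pareto_mgf Q (t i)) - A| <= s * eta.
  rewrite AE -sumrB etaE; apply: (le_trans (ler_norm_sum _ _ _)).
  by apply: ler_sum => i _.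
by rewrite !ler_expR; move: le1; rewrite ler_norml; lra.
Qed.

End Sketch.

(** * The algorithm and its error *)

Lemma bits_bij (T : finType) (d : nat) : #|T| = (2 ^ d)%N ->
  exists f : d.-tuple bool -> T, bijective f.
Proof.
move=> cT; have cB : #|{: d.-tuple bool}| = #|T|.
  by rewrite card_tuple card_bool cT.
exists (fun x => enum_val (cast_ord cB (enum_rank x))).
exists (fun y => enum_val (cast_ord (esym cB) (enum_rank y))) => z.
  by rewrite enum_valK cast_ordK enum_rankK.
by rewrite enum_valK cast_ordKV enum_rankK.
Qed.

(** Bijections with bit strings preserve the uniform law, so oracle, coins and memory may be any
    finite types whose sizes are powers of two. *)
Lemma alg_of_model (R : realType) (n M : nat) (Om C St : finType) (lo lc ls : nat)
    (st0 : St) (stp : Om -> C -> update n M -> St -> St) (ans : Om -> St -> R) :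
  #|Om| = (2 ^ lo)%N -> #|C| = (2 ^ lc)%N -> #|St| = (2 ^ ls)%N ->
  exists2 A : streaming_alg R n M, mem_bits A = ls &
  forall k (s : k.-tuple (update n M)) (P : pred R),
    prob R (fun w : randomness A k => P (run s w)) =
    mean (fun w : Om * k.-tuple C =>
      (P (ans w.1 (foldl (fun q (uc : update n M * C) => stp w.1 uc.2 uc.1 q)
                         st0 (zip s w.2))))%:R).
Proof.
move=> /bits_bij[fo [go foK goK]] /bits_bij[fc [gc fcK gcK]].
move=> /bits_bij[fs [gs fsK gsK]].
pose A : streaming_alg R n M := StreamingAlg (gs st0)
  (fun o c u q => gs (stp (fo o) (fc c) u (fs q))) (fun o q => ans (fo o) (fs q)).
exists A => // k s P.
have runE (w : randomness A k) :
    run s w = ans (fo w.1) (foldl (fun q (uc : update n M * C) =>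
      stp (fo w.1) uc.2 uc.1 q) st0 (zip s (map fc w.2))).
  rewrite /run /=; congr (ans _ _); rewrite -{2}[st0]gsK.
  elim: (tval s) (tval w.2) (gs st0) => [|u s' IH] [|c cs] q //=.
  by rewrite IH gsK.
pose h (w : randomness A k) : Om * k.-tuple C := (fo w.1, map_tuple fc w.2).
have hbij : bijective h.
  exists (fun w => (go w.1, map_tuple gc w.2)) => -[o t]; rewrite /h /=.
    by rewrite foK; congr (_, _); apply: val_inj; rewrite /= mapK.
  by rewrite goK; congr (_, _); apply: val_inj; rewrite /= mapK.
rewrite /prob /mean -(bij_eq_card hbij); congr (_ / _).
rewrite (reindex h) /=; last by apply: onW_bij.
rewrite -sum1_card natr_sum big_mkcond; apply: eq_bigr => w _.
by have /= <- := runE w; rewrite unfold_in; case: (P _).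
Qed.

Definition freq (n M : nat) (s : seq (update n M)) (i : 'I_n) : nat :=
  (\sum_(u <- s | u.1 == i) val u.2)%N.

Lemma final_vectorE n M (s : seq (update n M)) i :
  final_vector s 0 i = (freq s i)%:Z.
Proof.
suff foldE X : foldl (@apply_update n M) X s 0 i = X 0 i + (freq s i)%:Z.
  by rewrite /final_vector foldE mxE add0r.
rewrite /freq; elim: s X => [|u s IH] X /=; first by rewrite big_nil addr0.
rewrite IH mxE big_cons eq_sym; case: eqP => _; last by rewrite addr0.
by rewrite PoszD addrA.
Qed.

Lemma sum_freq n M (s : seq (update n M)) (w : 'I_n -> nat) :
  (\sum_(u <- s) val u.2 * w u.1 = \sum_i freq s i * w i)%N.
Proof.
under [RHS]eq_bigr do rewrite big_distrl /= big_mkcond.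
rewrite exchange_big /=; apply: eq_bigr => u _.
by rewrite -big_mkcond /= (big_pred1 u.1) // => i; rewrite eq_sym.
Qed.

Lemma entropyE (R : realType) n M (s : seq (update n M)) :
  entropy R (final_vector s) = nat_entropy R (freq s) / ln 2.
Proof.
have l1E : l1norm R (final_vector s) = (\sum_i freq s i)%N%:R.
  by rewrite /l1norm natr_sum; apply: eq_bigr => i _; rewrite final_vectorE.
rewrite /entropy l1E /nat_entropy -sumrN mulr_suml; apply: eq_bigr => i _.
have -> : `|final_vector s 0 i|%:~R = (freq s i)%:R :> R by rewrite final_vectorE.
rewrite /log2 mulrA.
set F := (\sum_j _)%N; have [->|x0] := posnP (freq s i).
  by rewrite !(mulr0n, mul0r) oppr0 mul0r.
have F0 : (0 < F)%N by rewrite /F (bigD1 i) //= ltn_addr.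
by rewrite -[in ln _]invf_div lnV ?mulrN // posrE divr_gt0 ?ltr0n.
Qed.

Lemma expR_near1 (R : realType) (y h : R) : h <= 1 / 2 -> `|y| <= h ->
  `|expR y - 1| <= 2 * h.
Proof.
move=> h2; rewrite ler_norml => /andP[y1 y2].
have e1 := expR_ge1Dx y.
have e2 : expR y * (1 - y) <= 1.
  rewrite -[leRHS](expRxMexpNx_1 y) ler_pM2l ?expR_gt0 //.
  exact: expR_ge1Dx.
have e0 := expR_gt0 y.
have e3 : expR y <= 2 by nra.
by rewrite ler_norml; apply/andP; split; nra.
Qed.

(** If [x <= 2 * L], the exponents differ by at most [6 * d * L <= eta / 2]. Otherwise [y] also
    exceeds [L], and both exponentials are below [eta * mu]. *)
Lemma expRN_perturb (R : realType) (x y d L eta mu : R) :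
  0 <= x -> 0 < d -> d <= 1 / 6 -> 0 < L -> eta <= 1 -> 12 * d * L <= eta ->
  expR (- L) <= eta * mu -> 0 < mu -> `|y - x| <= 3 * d * x ->
  `|expR (- y) - expR (- x)| <= eta * (expR (- x) + mu).
Proof.
move=> x0 d0 d1 L0 eta1 dL eL mu0 yx.
have eta0 : 0 < eta by apply: lt_le_trans dL; rewrite !mulr_gt0.
have ex := expR_gt0 (- x); have ey := expR_gt0 (- y).
have [xL|Lx] := leP x (2 * L); last first.
  have Ly : L <= y by move: yx; rewrite ler_norml => /andP[]; nra.
  have ey' : expR (- y) <= eta * mu by apply: le_trans eL; rewrite ler_expR lerN2.
  have ex' : expR (- x) <= eta * mu.
    by apply: le_trans eL; rewrite ler_expR lerN2; lra.
  have := mulr_gt0 eta0 ex.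
  by rewrite ler_norml => ?; apply/andP; split; lra.
have -> : expR (- y) - expR (- x) = expR (- x) * (expR (x - y) - 1).
  by rewrite mulrBr mulr1 -expRD addKr.
have xy : `|x - y| <= eta / 2.
  by rewrite distrC; apply: (le_trans yx); nra.
have h2 : eta / 2 <= 1 / 2 by lra.
have := expR_near1 h2 xy; rewrite mulrCA divff ?mulr1 ?pnatr_eq0 // => hh.
rewrite normrM (gtr0_norm ex); apply: (le_trans (ler_wpM2l (ltW ex) hh)).
by rewrite mulrC ler_pM2l //; lra.
Qed.

Lemma ratio_perturb (R : realType) (S F v f d : R) :
  0 <= S -> 0 < F -> 0 < d -> d <= 1 / 6 ->
  `|v - S| <= d * S -> `|f - F| <= d * F -> `|v / f - S / F| <= 3 * d * (S / F).
Proof.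
move=> S0 F0 d0 d1; rewrite !ler_norml => /andP[v1 v2] /andP[f1 f2].
have f0 : 0 < f by nra.
have q0 : 0 <= S / F by rewrite divr_ge0 // ltW.
have SE : S = S / F * F by rewrite mulfVK // lt0r_neq0.
set q := S / F in q0 SE *.
have dq : 0 <= d * q by rewrite mulr_ge0 // ltW.
have qF : 0 <= q * F by rewrite mulr_ge0 // ltW.
have dqF : 0 <= d * (q * F) by rewrite mulr_ge0 // ltW.
have ddqF : d * (d * (q * F)) <= 1 / 6 * (d * (q * F)) by rewrite ler_wpM2r.
have qf1 : q * f <= q * ((1 + d) * F) by rewrite ler_wpM2l //; lra.
have qf2 : q * ((1 - d) * F) <= q * f by rewrite ler_wpM2l //; lra.
have dqf2 : d * q * ((1 - d) * F) <= d * q * f by rewrite ler_wpM2l //; lra.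
rewrite SE in v1 v2; apply/andP; split.
  by rewrite lerBrDl ler_pdivlMr //; nra.
by rewrite lerBlDr ler_pdivrMr //; nra.
Qed.

Lemma ln2_ge_half (R : realType) : 1 / 2 <= ln 2 :> R.
Proof.
rewrite -ler_expR lnK ?posrE //.
have := expRxMexpNx_1 (1 / 2 : R); have := expR_ge1Dx (- (1 / 2) : R).
have := expR_gt0 (1 / 2 : R); nra.
Qed.

Lemma ln_ratio (R : realType) (a mu eta : R) : 0 < mu -> 0 < eta -> eta <= 1 ->
  `|a - mu| <= eta / 4 * mu -> `|ln a - ln mu| <= eta / 2.
Proof.
move=> mu0 eta0 eta1; rewrite ler_norml => /andP[a1 a2].
have a0 : 0 < a by nra.
have q0 : 0 < a / mu by rewrite divr_gt0.
rewrite -ln_div ?posrE // ler_norml; apply/andP; split.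
  rewrite lerNl -lnV ?posrE // invf_div.
  rewrite -{1}[mu / a](subrK 1) addrC; apply: (le_trans (le_ln1Dx _)).
    by have := divr_gt0 mu0 a0; lra.
  by rewrite lerBlDr ler_pdivrMr //; nra.
rewrite -{1}[a / mu](subrK 1) addrC; apply: (le_trans (le_ln1Dx _)); first by lra.
by rewrite lerBlDr ler_pdivrMr //; nra.
Qed.

(** Error budget in units of [eta * mu]: the counters cost [3 / 64] because [Z + mu <= 3 * mu],
    sampling costs [1 / 16] and the bias [1 / 16], in all less than [1 / 4]. *)
Lemma avg_expRN_perturb (R : realType) (J : nat) (S v : 'I_J -> R)
    (F f N mu m eta d L : R) :
  (0 < J)%N -> (forall j, 0 <= S j) -> 0 < F -> 0 < N -> 0 < d -> d <= 1 / 6 ->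
  0 < L -> 0 < mu -> eta <= 1 -> 12 * d * L <= eta / 64 ->
  expR (- L) <= eta / 64 * mu ->
  `|f - F| <= d * F -> (forall j, `|v j - S j| <= d * S j) ->
  `|(\sum_j expR (- (S j / (N * F)))) / J%:R - m| <= eta / 16 * mu ->
  `|m - mu| <= eta / 16 * mu ->
  `|(\sum_j expR (- (v j / (N * f)))) / J%:R - mu| <= eta / 4 * mu.
Proof.
move=> J0 S0 F0 N0 d0 d1 L0 mu0 eta1 dL eL fF vS avgm mmu.
have Jr : 0 < J%:R :> R by rewrite ltr0n.
have eta0 : 0 < eta by have := mulr_gt0 d0 L0; lra.
have close j : `|expR (- (v j / (N * f))) - expR (- (S j / (N * F)))| <=
    eta / 64 * (expR (- (S j / (N * F))) + mu).
  have NE (a c : R) : a / (N * c) = a / N / c by rewrite invfM mulrA.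
  apply: expRN_perturb dL eL _ _ => //; try lra.
    by rewrite divr_ge0 // mulr_ge0 // ltW.
  rewrite !NE; apply: ratio_perturb => //.
    by rewrite divr_ge0 // ltW.
  by rewrite -mulrBl normrM [`|N^-1|]gtr0_norm ?invr_gt0 // mulrA ler_pM2r ?invr_gt0.
set Z := (\sum_j expR (- (S j / (N * F)))) / J%:R in avgm.
set Z' := _ / J%:R.
have ZZ : `|Z' - Z| <= eta / 64 * (Z + mu).
  rewrite /Z' /Z -mulrBl -sumrB normrM [`|J%:R^-1|]gtr0_norm ?invr_gt0 //.
  rewrite ler_pdivrMr //; apply: (le_trans (ler_norm_sum _ _ _)).
  apply: (le_trans (ler_sum _ (fun j _ => close j))).
  rewrite -mulr_sumr big_split /= sumr_const card_ord -[leRHS]mulrA.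
  by rewrite mulrDl divfK ?lt0r_neq0 // mulr_natr.
have emu : eta * mu <= mu by rewrite ler_piMl // ltW.
have eZ : Z <= 2 * mu by move: avgm mmu; rewrite !ler_norml; lra.
have eeZ : eta * Z <= eta * (2 * mu) by rewrite ler_pM2l.
by move: ZZ avgm mmu; rewrite !ler_norml; lra.
Qed.

Section Entropy.
Variables (R : realType) (n : nat) (x : 'I_n -> nat).
Let F := (\sum_i x i)%N.

(** A nonzero count is at least 1, so [ln (F / x i) <= ln F]. This keeps the target [expR (- H) / N]
    above [1 / (F * N)]. *)
Lemma nat_entropy_le : (0 < F)%N -> nat_entropy R x <= ln F%:R.
Proof.
move=> F0; have Fr : 0 < F%:R :> R by rewrite ltr0n.
rewrite /nat_entropy -sumrN.
have -> : ln F%:R = \sum_i (x i)%:R / F%:R * ln F%:R :> R.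
  by rewrite -!mulr_suml -natr_sum divff ?mul1r // lt0r_neq0.
apply: ler_sum => i _; rewrite -mulrN; have [->|x0] := posnP (x i).
  by rewrite !mul0r.
rewrite ler_pM2l ?divr_gt0 ?ltr0n // -lnV ?posrE ?divr_gt0 ?ltr0n // invf_div.
rewrite ler_ln ?posrE ?divr_gt0 ?ltr0n // ler_pdivrMr ?ltr0n //.
by rewrite ler_peMr ?ler1n // ltW.
Qed.

End Entropy.

(** * The algorithm on finite types *)

Section Model.
Variables (R : realType) (n M J N q b E e' : nat).

Definition oracle : finType := {ffun 'I_J -> {ffun 'I_n * 'I_N -> 'I_(2 ^ q)}}.
Definition cell : finType := ('I_(2 ^ b.+1) * 'I_(2 ^ e'))%type.
(** [None] indexes the counter of the stream total, [Some j] that of the [j]-th sketch. *)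
Definition memory : finType := {ffun option 'I_J -> cell}.

Definition decode (p : cell) : nat := (p.1 * 2 ^ p.2)%N.

Definition cell0 : cell :=
  (Ordinal (expn_gt0 2 b.+1 : 0 < _)%N, Ordinal (expn_gt0 2 e' : 0 < _)%N).

(** Several mantissa and exponent pairs may denote [y]; any one will do. The default [cell0] stands
    for overflow, which [encodeK] excludes in range. *)
Definition encode (y : nat) : cell := odflt cell0 [pick p | decode p == y].

Definition increment (o : oracle) (j : option 'I_J) (u : update n M) : nat :=
  (u.2 * (if j is Some j' then weight (o j') u.1 else 1))%N.

Definition model_step (o : oracle) (c : 'I_(2 ^ E)) (u : update n M)
    (st : memory) : memory :=
  [ffun j => encode (rnd b E c (decode (st j) + increment o j u))].

(** Solves [mean = expR (- H) / N] for [H] and passes to base 2. The first branch covers the zero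
    vector, for which the quotient is meaningless. *)
Definition model_answer (o : oracle) (st : memory) : R :=
  if decode (st None) == 0%N then 0 else
  (- ln ((\sum_j expR (- ((decode (st (Some j)))%:R /
                          (N%:R * (decode (st None))%:R)))) / J%:R)
   - ln N%:R) / ln 2.

Definition memory0 : memory := [ffun => cell0].

Definition model_run (o : oracle) (s : seq (update n M)) cs : memory :=
  foldl (fun st (uc : update n M * 'I_(2 ^ E)) => model_step o uc.2 uc.1 st)
        memory0 (zip s cs).

Lemma encodeK y : (E < 2 ^ e')%N -> representable b E y ->
  (y < 2 ^ (E + b.+1))%N -> decode (encode y) = y.
Proof.
move=> Ee ry yub; rewrite /encode; case: pickP => [p /eqP //|/= none].
have e_lt : (cexp b E y < 2 ^ e')%N by apply: leq_ltn_trans Ee; rewrite geq_minl.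
have m_lt : (y %/ 2 ^ cexp b E y < 2 ^ b.+1)%N.
  rewrite ltn_divLR ?expn_gt0 // -expnD.
  have [->|y0] := posnP y; first by rewrite expn_gt0.
  have /andP[le2 lt2] := trunc_log_bounds (isT : 1 < 2)%N y0.
  rewrite /cexp; case: (leqP E (trunc_log 2 y - b)) => h.
    by rewrite addnC.
  by apply: (leq_trans lt2); rewrite leq_exp2l //; lia.
have := none (Ordinal m_lt, Ordinal e_lt).
by rewrite /decode /= divnK // eqxx.
Qed.

(** Counters never decrease, so a bound on the final value excludes overflow at every earlier
    step. *)
Lemma decode_run o s (cs : seq 'I_(2 ^ E)) j : (E < 2 ^ e')%N ->
  (approx_count b (increment o j) 0 s cs < 2 ^ (E + b.+1))%N ->
  decode (model_run o s cs j) = approx_count b (increment o j) 0 s cs.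
Proof.
move=> Ee.
suff gen (st : memory) v : representable b E v -> decode (st j) = v ->
    (approx_count b (increment o j) v s cs < 2 ^ (E + b.+1))%N ->
    decode (foldl (fun st (uc : update n M * 'I_(2 ^ E)) =>
      model_step o uc.2 uc.1 st) st (zip s cs) j) =
    approx_count b (increment o j) v s cs.
  by apply: gen; [rewrite /representable dvdn0 | rewrite ffunE].
elim: s cs st v => [|u s IH] [|c cs] st v //= rv dv.
rewrite /approx_count /= -/(approx_count b (increment o j) _ s cs) => ub.
apply: IH => //; first exact: rnd_representable.
rewrite ffunE dv encodeK //; first exact: rnd_representable.
by apply: leq_ltn_trans ub; apply: leq_approx_count; apply: rnd_representable.
Qed.

End Model.

(** * Success probability of the model *)

Section ModelCorrect.
Variables (R : realType) (n M J N q b E e' k : nat) (s : k.-tuple (update n M)).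
Variables (eta d L eps : R).
Let x : 'I_n -> nat := freq s.
Let F := (\sum_i x i)%N.
Hypotheses (J0 : (0 < J)%N) (Ee : (E < 2 ^ e')%N).
Hypotheses (eta0 : 0 < eta) (eta1 : eta <= 1) (eta_eps : eta <= eps).
Hypotheses (d0 : 0 < d) (d1 : d <= 1 / 6) (L0 : 0 < L).
(** [cap] leaves a factor 2 for the counter error above the largest total, and [Lbig] makes
    exponentials beyond [L] negligible against [mu]. [Jbig] and [bbig] let sampling and the counters
    each fail with probability at most [1 / 8]. *)
Hypothesis cap : (2 * (F * (N * 2 ^ q)) < 2 ^ (E + b.+1))%N.
Hypothesis Qbig : 2 * (F%:R * N%:R) ^+ 2 <= eta / 32 * (2 ^ q)%:R.
Hypothesis Nbig : 2 * 211 ^+ 2 <= (eta / 32) ^+ 2 * N%:R.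
Hypothesis Jbig : 16384 <= J%:R * eta ^+ 2.
Hypothesis Lsmall : 12 * d * L <= eta / 64.
Hypothesis Lbig : expR (- L) * (F%:R * N%:R) <= eta / 64.
Hypothesis bbig : 8 * J.+1%:R <= 2 ^+ b * d ^+ 2.

Let Om := oracle n J N q.
Let total (o : Om) j := (\sum_(u <- s) increment o j u)%N.
Let cnt (o : Om) (cs : k.-tuple 'I_(2 ^ E)) j := approx_count b (increment o j) 0 s cs.
Let mu : R := expR (- nat_entropy R x - ln N%:R).
Let g (w : {ffun 'I_n * 'I_N -> 'I_(2 ^ q)}) : R := expR (- sketch R x w).
Let avg (o : Om) : R := (\sum_j g (o j)) / J%:R.

Let Q0 : (0 < 2 ^ q)%N. Proof. by rewrite expn_gt0. Qed.

Let N0 : (0 < N)%N.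
Proof. by case: N Nbig => //; rewrite mulr0; lra. Qed.

Let mu0 : 0 < mu. Proof. exact: expR_gt0. Qed.

Let total_some o j : total o (Some j) = (\sum_i x i * weight (o j) i)%N.
Proof. exact: sum_freq s (weight (o j)). Qed.

Let total_none o : total o None = F.
Proof.
rewrite /total /increment (sum_freq s (fun=> 1%N)).
by apply: eq_bigr => i _; rewrite muln1.
Qed.

Let weight_gt0 (w : {ffun 'I_n * 'I_N -> 'I_(2 ^ q)}) i : (0 < weight w i)%N.
Proof.
by rewrite /weight (bigD1 (Ordinal N0)) //= ltn_addr // divn_gt0 ?ltn_ord.
Qed.

Let leq_weight (w : {ffun 'I_n * 'I_N -> 'I_(2 ^ q)}) i : (weight w i <= N * 2 ^ q)%N.
Proof.
rewrite -[X in (X * _)%N]card_ord -sum_nat_const; apply: leq_sum => t _.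
exact: leq_div.
Qed.

Let total_bounds o j : (F <= total o j <= F * (N * 2 ^ q))%N.
Proof.
case: j => [j|]; last by rewrite total_none leqnn leq_pmulr // muln_gt0 N0 Q0.
rewrite total_some big_distrl /=; apply/andP; split; apply: leq_sum => i _.
  by rewrite leq_pmulr.
by rewrite leq_mul2l leq_weight orbT.
Qed.

Let rep0 : representable b E 0. Proof. by rewrite /representable dvdn0. Qed.

(** Case [s = 1]: [expR] of [eta / 32] or of its opposite is within [eta / 16] of 1. *)
Let mean_g : F != 0%N -> `|mean g - mu| <= eta / 16 * mu.
Proof.
rewrite -lt0n => F0.
have e0 : 0 < eta / 32 by rewrite divr_gt0.
have [eta_gt0 eta_le1] := conj eta0 eta1; have mu_gt0 := mu0.
have e1 : eta / 32 <= 1 by lra.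
have := mean_expR_sketch_bounds F0 e0 e1 (lexx 1) (ler1n _ 2) Qbig Nbig (erefl _).
rewrite (eq_mean (g := g)); last by move=> w; rewrite mul1r.
rewrite !mul1r ln1 sub0r [- ln _ - _]addrC -/mu => /andP[lb ub].
have h2 : eta / 32 <= 1 / 2 by lra.
have near1 : `|eta / 32| <= eta / 32 by rewrite gtr0_norm.
have nearN1 : `|- (eta / 32)| <= eta / 32 by rewrite normrN.
have := expR_near1 h2 near1; have := expR_near1 h2 nearN1.
rewrite !ler_norml => /andP[l1 _] /andP[_ l2].
rewrite expRD -/mu in lb; rewrite expRD -/mu in ub.
by apply/andP; split; nra.
Qed.

(** Case [s = 2]: the term [2 * ln 2] of the exponent is the factor 4, and a further 2 absorbs the
    error. *)
Let mean_g2 : F != 0%N -> mean (fun w => g w ^+ 2) <= 8 * mu ^+ 2.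
Proof.
rewrite -lt0n => F0.
have e0 : 0 < eta / 32 by rewrite divr_gt0.
have [eta_gt0 eta_le1] := conj eta0 eta1; have mu_gt0 := mu0.
have e1 : eta / 32 <= 1 by lra.
have := mean_expR_sketch_bounds F0 e0 e1 (ler1n _ 2) (lexx 2) Qbig Nbig (erefl _).
rewrite (eq_mean (g := fun w => g w ^+ 2)); last first.
  by move=> w; rewrite /g -expRM_natl mulrN.
move=> /andP[_]; rewrite expRD.
have -> : expR (2 * (ln 2 - ln N%:R - nat_entropy R x)) = 4 * mu ^+ 2.
  rewrite (_ : _ - _ = ln 2 + (- nat_entropy R x - ln N%:R)); last by ring.
  by rewrite expRM_natl expRD lnK ?posrE // exprMn -natrX.
have h2 : 2 * (eta / 32) <= 1 / 2 by lra.
have near1 : `|2 * (eta / 32)| <= 2 * (eta / 32) by rewrite gtr0_norm //; lra.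
have := expR_near1 h2 near1; rewrite ler_norml => /andP[_ l2].
by have := exprn_gt0 2 mu0; nra.
Qed.

Let model_good o (cs : k.-tuple 'I_(2 ^ E)) : F != 0%N ->
  `|avg o - mean g| <= eta / 16 * mu ->
  (forall j, `|(cnt o cs j)%:R - (total o j)%:R| <= d * (total o j)%:R) ->
  `|model_answer R o (model_run b e' o s cs) - entropy R (final_vector s)| <= eps.
Proof.
rewrite -lt0n => F0 good_avg good_cnt.
have [eta_gt0 eta_le1] := conj eta0 eta1; have [d_gt0 d_le] := conj d0 d1.
have Fr : 0 < F%:R :> R by rewrite ltr0n.
have Nr : 0 < N%:R :> R by rewrite ltr0n.
(* Counters are within a factor [1 + d <= 2] of their totals, so by [cap] none overflows. *)
have decE j : decode (model_run b e' o s cs j) = cnt o cs j.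
  apply: decode_run => //; rewrite -/(cnt o cs j).
  apply: leq_ltn_trans cap; rewrite -(ler_nat R) natrM.
  have /andP[_ tub] := total_bounds o j.
  have := good_cnt j; rewrite ler_norml => /andP[_].
  rewrite -(ler_nat R) in tub; have := ler0n R (total o j); nra.
have cnt0 : 0 < (cnt o cs None)%:R :> R.
  have := good_cnt None; rewrite total_none ler_norml => /andP[+ _]; nra.
rewrite ltr0n in cnt0; rewrite /model_answer decE eqn0Ngt cnt0 /=.
under eq_bigr do rewrite decE.
set A := _ / J%:R; have eta_le := eta_eps.
have mu_lb : expR (- L) <= eta / 64 * mu.
  have FN0 : 0 < F%:R * N%:R :> R by rewrite mulr_gt0.
  have := Lbig; rewrite -ler_pdivlMr // => /le_trans; apply; rewrite ler_pM2l; last by lra.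
  have -> : (F%:R * N%:R)^-1 = expR (- ln F%:R - ln N%:R) :> R.
    by rewrite expRD !expRN !lnK ?posrE // invfM.
  by rewrite ler_expR lerD2r lerN2 nat_entropy_le.
have Aclose : `|A - mu| <= eta / 4 * mu.
  apply: (avg_expRN_perturb (S := fun j => (total o (Some j))%:R) (m := mean g)
    (F := F%:R) (f := (cnt o cs None)%:R) (v := fun j => (cnt o cs (Some j))%:R)
    _ _ _ _ _ _ _ _ _ Lsmall mu_lb) => //.
  - by have := good_cnt None; rewrite total_none.
  - have gE j : g (o j) = expR (- ((total o (Some j))%:R / (N%:R * F%:R))).
      by rewrite total_some.
    by move: good_avg; rewrite /avg (eq_bigr _ (fun j _ => gE j)).
  - by apply: mean_g; rewrite -lt0n.
have := ln_ratio mu0 eta0 eta1 Aclose.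
rewrite {1}/mu expRK entropyE -mulrBl normrM => lnA.
(* Passing to base 2 at most doubles the error [eta / 2]. *)
have l2 := ln2_ge_half R.
have l20 : 0 < ln 2 :> R by lra.
rewrite [`|_^-1|]gtr0_norm ?invr_gt0 // ler_pdivrMr //.
have -> : - ln A - ln N%:R - nat_entropy R (freq s) =
    - (ln A - (- nat_entropy R x - ln N%:R)) by rewrite /x; ring.
by rewrite normrN; apply: (le_trans lnA); nra.
Qed.

(* If the estimate is off by more than [eps], then one of the subtracted squares
   exceeds 1; taking means, this is Chebyshev's inequality and the union bound. *)
Let indicator_lb (o : Om) (cs : k.-tuple 'I_(2 ^ E)) : F != 0%N ->
  1 - ((eta / 16 * mu) ^+ 2)^-1 * (avg o - mean g) ^+ 2
    - \sum_j ((d * (total o j)%:R) ^+ 2)^-1 *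
        ((cnt o cs j)%:R - (total o j)%:R) ^+ 2 <=
  (`|model_answer R o (model_run b e' o s cs) -
     entropy R (final_vector s)| <= eps)%R%:R.
Proof.
move=> F0; set X := _ * (avg o - _) ^+ 2; set Y := \sum_j _.
have X0 : 0 <= X by rewrite mulr_ge0 ?invr_ge0 ?sqr_ge0.
have Y0 : 0 <= Y by apply: sumr_ge0 => j _; rewrite mulr_ge0 ?invr_ge0 ?sqr_ge0.
case: (boolP (_ <= eps)) => [_|bad]; first by rewrite mulr1n; lra.
rewrite leNgt; apply: contra bad => lt1.
have sq_le (a c : R) : 0 < c -> (c ^+ 2)^-1 * a ^+ 2 <= 1 -> `|a| <= c.
  move=> c0; rewrite ler_pdivrMl ?exprn_gt0 // mulr1 -(real_normK (num_real a)).
  by rewrite ler_pXn2r ?nnegrE ?normr_ge0 // ltW.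
apply: model_good => //.
  by apply: sq_le; [rewrite mulr_gt0 // divr_gt0 | rewrite mulr0n in lt1; rewrite -/X; lra].
move=> j; apply: sq_le.
  rewrite mulr_gt0 // ltr0n; have /andP[+ _] := total_bounds o j.
  by apply: leq_trans; rewrite lt0n.
apply: (@le_trans _ _ Y); last by rewrite mulr0n in lt1; lra.
rewrite /Y (bigD1 j) //= lerDl; apply: sumr_ge0 => i _.
by rewrite mulr_ge0 ?invr_ge0 ?sqr_ge0.
Qed.

Lemma model_correct :
  3 / 4 <= mean (fun w : Om * k.-tuple 'I_(2 ^ E) =>
    (`|model_answer R w.1 (model_run b e' w.1 s w.2) -
       entropy R (final_vector s)| <= eps)%R%:R : R).
Proof.
pose c0 : 'I_(2 ^ E) := Ordinal (expn_gt0 2 E : 0 < _)%N.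
pose w0 : {ffun 'I_n * 'I_N -> 'I_(2 ^ q)} := [ffun=> Ordinal Q0].
pose o0 : Om := [ffun=> w0].
pose cs0 : k.-tuple 'I_(2 ^ E) := [tuple of nseq k c0].
(* For total 0 the counter of the total stays at 0 and the answer 0 is always right. *)
have [F0|F0] := eqVneq F 0%N.
  rewrite (eq_mean (g := fun=> 1)) ?(mean_cst (o0, cs0)); first by lra.
  case=> o cs /=; rewrite (_ : model_answer _ _ _ = 0).
    rewrite entropyE /nat_entropy big1 ?oppr0 ?mul0r ?subrr ?normr0.
      by rewrite (le_trans (ltW eta0)).
    move=> i _; have /eqP := F0; rewrite sum_nat_eq0 => /forallP /(_ i) /eqP xi.
    by rewrite [freq s i]xi !mul0r.
  have c00 : approx_count b (increment o None) 0 s cs = 0%N.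
    by apply: approx_count0 => //; rewrite -[LHS]/(total o None) total_none.
  by rewrite /model_answer decode_run // c00 ?eqxx // expn_gt0.
rewrite mean_pair /=.
(* For a fixed oracle, each of the [J.+1] counters costs at most [1 / (2 ^+ b * d ^+ 2)], together
   at most [1 / 8]. *)
have inner o : mean (fun cs : k.-tuple 'I_(2 ^ E) =>
    1 - ((eta / 16 * mu) ^+ 2)^-1 * (avg o - mean g) ^+ 2
    - \sum_j ((d * (total o j)%:R) ^+ 2)^-1 *
        ((cnt o cs j)%:R - (total o j)%:R) ^+ 2) >=
    7 / 8 - ((eta / 16 * mu) ^+ 2)^-1 * (avg o - mean g) ^+ 2.
  rewrite meanD meanN (mean_cst cs0) mean_sum.
  suff : \sum_j mean (fun cs : k.-tuple 'I_(2 ^ E) => ((d * (total o j)%:R) ^+ 2)^-1 *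
      ((cnt o cs j)%:R - (total o j)%:R) ^+ 2) <= 1 / 8 by lra.
  apply: (@le_trans _ _ (\sum_(j : option 'I_J) (2 ^+ b * d ^+ 2)^-1)).
    apply: ler_sum => j _; rewrite meanZ.
    have tot0 : 0 < (total o j)%:R :> R.
      rewrite ltr0n; have /andP[+ _] := total_bounds o j.
      by apply: leq_trans; rewrite lt0n.
    have := mean_approx_count_var R (increment o j) (size_tuple s) rep0.
    rewrite add0n => vle; rewrite ler_pdivrMl ?exprn_gt0 ?mulr_gt0 //.
    apply: (le_trans vle); rewrite le_eqVlt; apply/orP; left; apply/eqP.
    by field; rewrite !lt0r_neq0 // exprn_gt0.
  rewrite sumr_const card_option card_ord -(mulr_natl (_ ^-1)).
  rewrite ler_pdivrMr; last by rewrite mulr_gt0 ?exprn_gt0.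
  by have := bbig; lra.
apply: (@le_trans _ _ (mean (fun o : Om =>
    7 / 8 - ((eta / 16 * mu) ^+ 2)^-1 * (avg o - mean g) ^+ 2))); last first.
  apply: ler_mean => o; apply: (le_trans (inner o)).
  by apply: ler_mean => cs; apply: indicator_lb.
rewrite meanD meanN (mean_cst o0).
have J1 : (0 < #|'I_J|)%N by rewrite card_ord.
have := mean_avg_var w0 g J1; rewrite card_ord => avg_var.
(* Sampling costs the other [1 / 8]: [8 * mu ^+ 2 / J] is compared with [(eta / 16 * mu) ^+ 2], and
   [16384 = 8 * 8 * 16 ^ 2]. *)
suff : ((eta / 16 * mu) ^+ 2)^-1 * mean (fun o : Om => (avg o - mean g) ^+ 2) <= 1 / 8.
  by rewrite -meanZ /=; lra.
have em0 : 0 < eta / 16 * mu by rewrite mulr_gt0 // divr_gt0.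
rewrite ler_pdivrMl ?exprn_gt0 //.
apply: (le_trans avg_var); rewrite ler_pdivrMr ?ltr0n //.
apply: (le_trans (mean_g2 F0)).
have -> : (eta / 16 * mu) ^+ 2 * (1 / 8) * J%:R =
  J%:R * eta ^+ 2 * mu ^+ 2 / 2048 by field.
by have := ler_wpM2r (sqr_ge0 mu) Jbig; have := exprn_gt0 2 mu0; lra.
Qed.

End ModelCorrect.

(** * Choice of the parameters *)

Lemma pow2_approx (R : realType) (y : R) : 1 <= y ->
  exists2 a : nat, y <= 2 ^+ a <= 2 * y & a%:R <= log2 y + 1.
Proof.
move=> y1; have ex_a : exists a : nat, y <= 2 ^+ a.
  exists (Num.truncn y).+1; have y0 : 0 <= y by lra.
  have /andP[_ yub] := truncn_itv y0; apply: (le_trans (ltW yub)).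
  by rewrite -natrX ler_nat ltnW // ltn_expl.
have [a ya amin] := ex_minnP ex_a.
have a_ub : 2 ^+ a <= 2 * y.
  case: a ya amin => [|a] ya amin; first by rewrite expr0; lra.
  rewrite exprS ler_pM2l // leNgt; apply/negP => /ltW /amin.
  by rewrite ltnn.
exists a; first by rewrite ya.
have l2 := ln2_ge_half R; have l20 : 0 < ln 2 :> R by lra.
rewrite /log2 -[X in _ + X](divff (lt0r_neq0 l20)) -mulrDl ler_pdivlMr //.
rewrite mulr_natl -lnXn // addrC -lnM ?posrE //; last by lra.
by rewrite ler_ln ?posrE ?exprn_gt0 //; lra.
Qed.

Lemma ler_log2 (R : realType) (y z : R) : 0 < y -> y <= z -> log2 y <= log2 z.
Proof.
move=> y0 yz; have l2 := ln2_ge_half R.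
rewrite ler_pM2r ?invr_gt0; last by lra.
by rewrite ler_ln ?posrE //; apply: lt_le_trans yz.
Qed.

Lemma log2M (R : realType) (y z : R) : 0 < y -> 0 < z ->
  log2 (y * z) = log2 y + log2 z.
Proof. by move=> y0 z0; rewrite /log2 lnM ?posrE // mulrDl. Qed.

Lemma log2_2 (R : realType) : log2 2 = 1 :> R.
Proof. by have := ln2_ge_half R => l2; rewrite /log2 divff //; lra. Qed.

(** From [2 ^ 3 <= 3 ^ 2] and [2 <= (3 / 2) ^ 2]. Additive constants in the space can then be
    absorbed into [log2 (log2 n)]. *)
Lemma log2_log2_ge (R : realType) (n : nat) : (2 < n)%N ->
  3 / 2 <= log2 n%:R :> R /\ 1 / 2 <= log2 (log2 n%:R) :> R.
Proof.
move=> n3.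
have half (y : R) (p : nat) : 0 < y -> 2 ^+ p <= y ^+ 2 -> p%:R / 2 <= log2 y.
  move=> y0 py; have := ler_log2 (exprn_gt0 p (ltr0n _ 2)) py.
  rewrite expr2 log2M // /log2 lnXn // -[ln 2 *+ p]mulr_natl.
  by rewrite -mulrA -/(log2 2) log2_2; lra.
have n3' : 3 <= n%:R :> R by rewrite ler_nat.
have l3 : 3 / 2 <= log2 n%:R :> R.
  by apply: (half _ 3); [lra | rewrite !exprS expr0; nra].
split => //; have := half (log2 n%:R) 1%N; rewrite expr1 expr2; apply; nra.
Qed.

Lemma sum_freq_le n M (s : seq (update n M)) :
  (\sum_i freq s i <= size s * M)%N.
Proof.
have := sum_freq s (fun=> 1%N).
under [in RHS]eq_bigr do rewrite muln1.
move=> <-; elim: s => [|u s IH]; first by rewrite big_nil.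
by rewrite big_cons muln1 mulSn leq_add // -ltnS ltn_ord.
Qed.

(** Exponents up to [E] fit in [lam + a + (6 * c + 100)] bits, with [lam] about [log2 (log2 n)]: the
    sum is below the product of [l], [a.+1] and [6 * c + 101]. *)
Lemma exponent_bound (c l lam a : nat) : (0 < l)%N -> (l <= 2 ^ lam)%N ->
  (3 * (2 * c * l) + 7 * a + 88 < 2 ^ (lam + a + (6 * c + 100)))%N.
Proof.
move=> l0 ll; rewrite [(2 ^ (lam + _ + _))%N]expnD [(2 ^ (lam + _))%N]expnD.
have ha : (a.+1 <= 2 ^ a)%N by apply: ltn_expl.
have hc : ((6 * c + 100).+1 <= 2 ^ (6 * c + 100))%N by apply: ltn_expl.
apply: (leq_trans _ (leq_mul (leq_mul ll ha) hc)); nia.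
Qed.

Lemma pow2_succ_le (R : realType) (a : nat) :
  (2 ^ (2 * a + 14)).+1%:R <= 2 ^+ 15 * (2 ^+ a) ^+ 2 :> R.
Proof.
have lt_pow : (2 ^ (2 * a + 14) < 2 ^ (15 + a * 2))%N.
  by rewrite ltn_exp2l //; lia.
by rewrite -(ler_nat R) natrX exprD exprM in lt_pow.
Qed.

(** The choices are [eta = 2^(-a)], [d = 2^(-(a + 10 + p))] and [L = f + 3 * a + 33]. Then
    [(eta / 32)^2 * N = 2^17], [J * eta^2 = 2^14], [2^b * d^2 = 2^(2 * a + 18)], and [q] makes
    [eta / 32 * 2^q] twice the square of the bound [X] on [F * N]. The largest total is at most
    [2^(3 * f + 7 * a + 87)], just below [2^E]. *)
Lemma model_correct_pow2 (R : realType) (n M k a f p : nat)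
    (s : k.-tuple (update n M)) (eps : R)
    (N := (2 ^ (2 * a + 27))%N) (J := (2 ^ (2 * a + 14))%N)
    (q := (5 + a + (1 + 2 * (f + (2 * a + 27))))%N)
    (b := (2 * (a + 10 + p) + (2 * a + 18))%N) (E := (3 * f + 7 * a + 88)%N) :
  (2 ^+ a)^-1 <= eps -> (\sum_i freq s i <= 2 ^ f)%N -> (E < 2 ^ p)%N ->
  3 / 4 <= mean (fun w : oracle n J N q * k.-tuple 'I_(2 ^ E) =>
    (`|model_answer R w.1 (model_run b p w.1 s w.2) -
       entropy R (final_vector s)| <= eps)%R%:R : R).
Proof.
move=> a_eps F_le E_lt; pose F := (\sum_i freq s i)%N.
have A0 : 0 < 2 ^+ a :> R by rewrite exprn_gt0.
have ea0 : 0 < (2 ^+ a)^-1 :> R by rewrite invr_gt0.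
pose X : R := 2 ^+ (f + (2 * a + 27)).
have X0 : 0 < X by rewrite exprn_gt0.
have FN_le : F%:R * N%:R <= X.
  by rewrite /X -natrX -natrM ler_nat expnD leq_mul.
have FN0 : 0 <= F%:R * N%:R :> R by rewrite mulr_ge0.
pose D : R := 2 ^+ (a + 10 + p).
have D0 : 0 < D by rewrite exprn_gt0.
apply: (@model_correct R n M J N q b E p k s (2 ^+ a)^-1 D^-1
         (f + 3 * a + 33)%:R eps) => //.
- by rewrite expn_gt0.
- by rewrite invf_le1 // exprn_ege1 // ler1n.
- by rewrite invr_gt0.
- rewrite -[1 / 6]invrK lef_pV2 ?posrE ?invr_gt0 //; last by lra.
  apply: (@le_trans _ _ (2 ^+ 3)); first by lra.
  by rewrite ler_eXn2l ?ltr1n // -addnA (addnC a) -!addnA; lia.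
- by rewrite ltr0n addnS.
- rewrite addnS expnS ltn_pmul2l //.
  apply: (@leq_ltn_trans (2 ^ f * (N * 2 ^ q))); first by rewrite leq_mul.
  by rewrite -!expnD ltn_exp2l // /E /b /q; lia.
- have -> : (2 ^+ a)^-1 / 32 * (2 ^ q)%:R = 2 * X ^+ 2 :> R.
    rewrite natrX /q exprD exprD (exprD _ 1) (exprM _ 2) exprAC -/X.
    by field; rewrite lt0r_neq0.
  by rewrite ler_pM2l // lerXn2r // nnegrE ltW.
- have -> : ((2 ^+ a)^-1 / 32) ^+ 2 * N%:R = 2 ^+ 17 :> R.
    rewrite natrX exprD mulnC (exprM _ a).
    by field; rewrite lt0r_neq0.
  by lra.
- rewrite natrX exprD mulnC (exprM _ a).
  rewrite [X in _ <= X](_ : _ = 2 ^+ 14); first by lra.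
  by field; rewrite lt0r_neq0.
- have L_le : (f + 3 * a + 33)%:R <= 2 ^+ p :> R.
    by rewrite -natrX ler_nat; apply: leq_trans (ltnW E_lt); rewrite /E; lia.
  rewrite /D exprD exprD mulrAC ler_pdivrMr ?mulr_gt0 ?exprn_gt0 //.
  rewrite [X in _ <= X](_ : _ = 16 * 2 ^+ p); first by have := exprn_gt0 p (ltr0n R 2); lra.
  by field; rewrite lt0r_neq0.
(* Since [expR 1 >= 2], the exponential is replaced by a power of two, and the exponents then match
   exactly. *)
- have eL : expR (- (f + 3 * a + 33)%:R) <= (2 ^+ (f + 3 * a + 33))^-1 :> R.
    rewrite expRN lef_pV2 ?posrE ?expR_gt0 ?exprn_gt0 //.
    rewrite -[(_ + _ + _)%:R]mulr1 expRM_natl lerXn2r ?nnegrE ?expR_ge0 //.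
    by have := expR_ge1Dx (1 : R); lra.
  apply: (le_trans (ler_pM (expR_ge0 _) FN0 eL FN_le)).
  rewrite /X le_eqVlt; apply/orP; left; apply/eqP.
  rewrite (_ : f + 3 * a + 33 = f + (2 * a + 27) + (a + 6))%N; last by lia.
  rewrite exprD -/X exprD.
  by field; rewrite !lt0r_neq0.
- have -> : 2 ^+ b * D^-1 ^+ 2 = 2 ^+ 18 * (2 ^+ a) ^+ 2 :> R.
    rewrite /b exprD mulnC (exprM _ _ 2) -/D exprD mulnC (exprM _ a).
    by field; rewrite lt0r_neq0.
  have J1 : J.+1%:R <= 2 ^+ 15 * (2 ^+ a) ^+ 2 :> R by apply: pow2_succ_le.
  have -> : 2 ^+ 18 * (2 ^+ a) ^+ 2 = 8 * (2 ^+ 15 * (2 ^+ a) ^+ 2) :> R by ring.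
  by rewrite ler_pM2l.
Qed.

Theorem theorem27 (R : realType) (c : nat) :
  exists2 C : R, 0 < C &
  forall (n m M : nat) (eps : R),
    (2 < n)%N -> (m <= n ^ c)%N -> (M <= n ^ c)%N -> 0 < eps -> eps < 1 ->
  exists2 A : streaming_alg R n M,
    (mem_bits A)%:R <=
      C * (1 / eps ^+ 2 * (log2 (log2 n%:R) + log2 (1 / eps))) &
    forall (k : nat) (s : k.-tuple (update n M)), (k <= m)%N ->
      3 / 4 <= prob R (fun w : randomness A k =>
        `|run s w - entropy R (final_vector s)| <= eps).
Proof.
pose kc := (6 * c + 100)%N.
(* The factor [2 ^+ 17] comes from [J.+1] cells with [2 ^+ a <= 2 / eps]. The other one bounds the
   cell size [7 * a + 3 * lam + 3 * kc + 39], its constants being absorbed through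
   [log2 (log2 n) >= 1 / 2]. *)
exists (2 ^+ 17 * (6 * kc%:R + 111)).
  by rewrite mulr_gt0 ?exprn_gt0 // ltr_wpDl // mulr_ge0.
move=> n m M eps n2 mn Mn eps0 eps1.
have eV : 1 <= 1 / eps by rewrite ler_pdivlMr // mul1r ltW.
have [a /andP[a_lb a_ub] a_log] := pow2_approx eV.
have n1 : 1 <= n%:R :> R by rewrite ler1n; apply: leq_trans n2.
have [l /andP[l_lb l_ub] l_log] := pow2_approx n1.
have [logn loglogn] := log2_log2_ge R n2.
have l_gt0 : (0 < l)%N.
  by case: l l_lb {l_ub l_log} => //; rewrite expr0 -(ler_nat R) => ?; move: n2;
     rewrite -(ltr_nat R); lra.
have l1 : 1 <= l%:R :> R by rewrite ler1n.
have [lam /andP[lam_lb _] lam_log] := pow2_approx l1.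
have lam_le : lam%:R <= log2 (log2 n%:R) + 2 :> R.
  apply: (le_trans lam_log).
  have : log2 l%:R <= log2 (2 * log2 n%:R) :> R by apply: ler_log2; lra.
  by rewrite log2M ?log2_2 //; lra.
have lam_nat : (l <= 2 ^ lam)%N by rewrite -(ler_nat R) natrX.
pose p := (lam + a + kc)%N.
(* The stream total is at most [n ^ c * n ^ c], and [n <= 2 ^ l]. *)
pose f := (2 * c * l)%N.
pose E := (3 * f + 7 * a + 88)%N.
have E_lt : (E < 2 ^ p)%N by apply: exponent_bound.
pose N := (2 ^ (2 * a + 27))%N.
pose J := (2 ^ (2 * a + 14))%N.
pose q := (5 + a + (1 + 2 * (f + (2 * a + 27))))%N.
pose b := (2 * (a + 10 + p) + (2 * a + 18))%N.
have cell_bits : (b.+1 + p = 7 * a + 3 * lam + 3 * kc + 39)%N.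
  by rewrite /b /p; clear; lia.
have cOm : #|oracle n J N q| = (2 ^ (q * (n * N) * J))%N.
  by rewrite !card_ffun card_prod !card_ord !expnM.
have cSt : #|memory J b p| = (2 ^ ((b.+1 + p) * J.+1))%N.
  by rewrite card_ffun card_prod !card_ord card_option card_ord -expnD -expnM.
have [A A_bits A_prob] := alg_of_model (memory0 J b p)
  (@model_step n M J N q b E p) (model_answer R (b := b) (e' := p))
  cOm (card_ord (2 ^ E)) cSt.
have A0 : 0 < 2 ^+ a :> R by rewrite exprn_gt0.
exists A.
  rewrite A_bits natrM.
  have b_le : (b.+1 + p)%:R <=
      (6 * kc%:R + 111) * (log2 (log2 n%:R) + log2 (1 / eps)) :> R.
    rewrite cell_bits 3!natrD 3!natrM.
    have logeps : 0 <= log2 (1 / eps).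
      by rewrite divr_ge0 ?ln_ge0 //; have := ln2_ge_half R; lra.
    have k0 := ler0n R kc; nra.
  have J_le : J.+1%:R <= 2 ^+ 17 * (1 / eps ^+ 2) :> R.
    apply: (le_trans (pow2_succ_le R a)).
    have -> : 2 ^+ 17 * (1 / eps ^+ 2) = 2 ^+ 15 * (2 * (1 / eps)) ^+ 2.
      by field; rewrite lt0r_neq0.
    by rewrite ler_pM2l ?exprn_gt0 // lerXn2r // nnegrE ltW // (lt_le_trans A0).
  rewrite (_ : 2 ^+ 17 * _ * _ =
    (6 * kc%:R + 111) * (log2 (log2 n%:R) + log2 (1 / eps)) *
    (2 ^+ 17 * (1 / eps ^+ 2))); last by ring.
  by apply: ler_pM.
move=> k s km.
rewrite (A_prob k s (fun r => `|r - entropy R (final_vector s)| <= eps)).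
have F_le : (\sum_i freq s i <= 2 ^ f)%N.
  apply: (leq_trans (sum_freq_le s)); rewrite size_tuple.
  have nl : (n <= 2 ^ l)%N by rewrite -(ler_nat R) natrX.
  have nc : (n ^ c <= 2 ^ (l * c))%N.
    by rewrite expnM; case: (posnP c) => [->|c0] //; rewrite leq_exp2r.
  apply: (@leq_trans (n ^ c * n ^ c)); first by rewrite leq_mul // (leq_trans km).
  by apply: (leq_trans (leq_mul nc nc)); rewrite -expnD leq_exp2l // addnn -mul2n /f -mulnA (mulnC c).
by apply: model_correct_pow2; rewrite // -[eps]invrK lef_pV2 ?posrE ?invr_gt0 //
  -[eps^-1]mul1r.
Qed.
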